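(* For any $K\in\mathcal{K}^{\mathrm i}$, we have $\mathcal{A}(K)\le\mathcal{Q}(K,B_K,D_K)$.
   Context: $|X|$ is area. $u_t=(\cos t,\sin t)$, $v_t=(-\sin t,\cos t)$, $S^1=\mathbb{R}/2\pi\mathbb{Z}$. For a convex body $K$ (nonempty compact convex subset of $\mathbb{R}^2$): $h_K(t)=\sup_{p\in K}p\cdot u_t$; the edge is $e_K(t)=\{p\in K:p\cdot u_t=h_K(t)\}$; $v_K^+(t)$ (resp. $v_K^-(t)$) is the endpoint of $e_K(t)$ farthest in direction $v_t$ (resp. $-v_t$); $\sigma_K$ is the surface area measure on $S^1$. The constant $\varphi$: $(p,q,\varphi,\theta)$ is the solution with $0<\varphi<\theta<\pi/4$ (numerically $p\approx 0.0944265608$, $q\approx 1.3992037273$, $\varphi\approx 0.0391773648$, $\theta\approx 0.6813015094$) of $p(\cos\theta-\cos\varphi)-2q\sin\varphi+(\theta-\varphi-1)\cos\theta-\sin\theta+\cos\varphi+\sin\varphi=0$, $p(3\sin\theta+\sin\varphi)-2q\cos\varphi+3(\theta-\varphi-1)\sin\theta+3\cos\theta-\sin\varphi+\cos\varphi=0$, $p\cos\varphi=\sin\varphi+\frac12-\frac12\cos\varphi+q\sin\varphi$, $p+\frac{\pi}{2}-\varphi-\theta=q-\frac12(\theta-\varphi)(1+p)-\frac14(\theta-\varphi)^2$. Put $\varphi^{\mathrm R}=\varphi$, $\varphi^{\mathrm L}=\pi/2-\varphi$. Caps. A cap (rotation angle $\pi/2$) is a convex body $K$ with $h_K(\pi/2)=1$,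 $h_K(3\pi/2)=0$, which is an intersection of closed half-planes $\{p\cdot u_t\le c\}$ with $t\in[0,\pi]\cup\{3\pi/2\}$. Let $\mathbf{x}_K(t)=(h_K(t)-1)u_t+(h_K(t+\pi/2)-1)v_t$ and $Q_K^-(t)=\{p:p\cdot u_t<h_K(t)-1,\ p\cdot v_t<h_K(t+\pi/2)-1\}$. The niche is $\mathcal{N}(K)=\{y\ge0\}\cap\bigcup_{t\in(0,\pi/2)}Q_K^-(t)$ and $\mathcal{A}(K)=|K|-|\mathcal{N}(K)|$. $\mathcal{K}^{\mathrm i}$ is the set of caps $K$ with $|K|\ge2.2$ satisfying the injectivity condition: (1) $\sigma_K$ restricted to $[0,\pi/2)$ and to $(\pi/2,\pi]$ is absolutely continuous with respect to Lebesgue measure (has nonnegative measurable densities); (2) $\mathbf{x}_K:[0,\pi/2]\to\mathbb{R}^2$ is continuously differentiable; (3) $\mathbf{x}_K'(t)\cdot u_t<0$ and $\mathbf{x}_K'(t)\cdot v_t>0$ for all $t\in(0,\pi/2)$. For $K\in\mathcal{K}^{\mathrm i}$ define the convex bodies $B_K=K\cap\bigcap_{t\in[\varphi^{\mathrm R},\pi/2]}\{p:p\cdot u_t\ge h_K(t)-1\}$ and $D_K=K\cap\bigcap_{t\in[0,\varphi^{\mathrm L}]}\{p:p\cdot v_t\ge h_K(t+\pi/2)-1\}$. Curve area. For a continuous $\mathbf{z}=(x,y):[a,b]\to\mathbb{R}^2$ of bounded variation, $\mathcal{J}(\mathbf{z})=\frac12\int_a^b x\,dy-y\,dx$ (Stieltjes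 integrals); it depends only on the oriented curve. For points $p=(p_1,p_2)$, $q=(q_1,q_2)$, $\mathcal{J}(p,q)=\frac12(p_1q_2-p_2q_1)$. For a convex body $X$ and $a<b<a+\pi$, $\mathbf{u}_X^{a,b}=\{v_X^+(a)\}\cup\bigcup_{t\in(a,b)}e_X(t)\cup\{v_X^-(b)\}$, an oriented rectifiable arc (possibly a point) of $\partial X$ from $v_X^+(a)$ to $v_X^-(b)$. The functional. For $K\in\mathcal{K}^{\mathrm i}$ and convex bodies $B,D$, $$\mathcal{Q}(K,B,D)=|K|+\mathcal{J}(\mathbf{d}_D)+\mathcal{J}(Y_D,\mathbf{x}_K^{\mathrm L})-\mathcal{J}\bigl(\mathbf{x}_K|_{[\varphi^{\mathrm R},\varphi^{\mathrm L}]}\bigr)+\mathcal{J}(\mathbf{x}_K^{\mathrm R},X_B)+\mathcal{J}(\mathbf{b}_B),$$ where $\mathbf{b}_B=\mathbf{u}_B^{\pi+\varphi^{\mathrm R},3\pi/2}$, $X_B=v_B^+(\pi+\varphi^{\mathrm R})$, $\mathbf{d}_D=\mathbf{u}_D^{3\pi/2,3\pi/2+\varphi^{\mathrm L}}$, $Y_D=v_D^-(3\pi/2+\varphi^{\mathrm L})$, $\mathbf{x}_K^{\mathrm R}=\mathbf{x}_K(\varphi^{\mathrm R})$, $\mathbf{x}_K^{\mathrm L}=\mathbf{x}_K(\varphi^{\mathrm L})$. *)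

(* Defs.v *)
From HB Require Import structures.
From mathcomp Require Import all_boot all_order all_algebra.
From mathcomp Require Import all_classical all_reals all_analysis.

Set Implicit Arguments.
Unset Strict Implicit.
Unset Printing Implicit Defensive.

Import Order.TTheory GRing.Theory Num.Theory.
Import numFieldNormedType.Exports.

Local Open Scope classical_set_scope.
Local Open Scope ring_scope.

Section plane.
Context {R : realType}.
Implicit Types (p q : R * R) (X K B D : set (R * R)) (s t a b c d : R).

Definition dot p q : R := p.1 * q.1 + p.2 * q.2.

Definition u_ t : R * R := (cos t, sin t).
Definition v_ t : R * R := (- sin t, cos t).

(* Only applied to measurable sets of finite measure, on which [fine] loses
   nothing. *)
Definition area X : R := fine ((lebesgue_measure \x lebesgue_measure)%E X).

Definition convex_body X :=
  [/\ X !=set0, compact X & convex_set (X : set (convex_lmodType (R * R)%type))].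

(* The circle is represented by real angles; [support_fun X], [edge X], [v_plus X]
   and [v_minus X] are 2 pi-periodic. *)
Definition support_fun X t : R := sup [set dot p (u_ t) | p in X].

Definition edge X t : set (R * R) :=
  [set p | X p /\ dot p (u_ t) = support_fun X t].

Definition v_plus X t : R * R :=
  xget 0 [set p | edge X t p /\ forall q, edge X t q -> dot q (v_ t) <= dot p (v_ t)].

Definition v_minus X t : R * R :=
  xget 0 [set p | edge X t p /\ forall q, edge X t q -> dot p (v_ t) <= dot q (v_ t)].

(* The canonical norm of [R * R] is the sup norm, hence the explicit Euclidean
   distance. *)
Definition eucl_dist p q : R := Num.sqrt (dot (p - q) (p - q)).

(* The added 0 makes the diameter of the empty set 0. *)
Definition diameter X : \bar R :=
  ereal_sup ([set 0%E] `|` [set (eucl_dist p q)%:E | p in X & q in X]).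

(* One-dimensional Hausdorff measure. *)
Definition hausdorff1 X : \bar R :=
  ereal_sup [set ereal_inf
      [set (\sum_(0 <= i <oo) diameter (F i))%E | F in
        [set F : nat -> set (R * R) |
          X `<=` \bigcup_i F i /\ forall i, (diameter (F i) <= d%:E)%E]]
    | d in [set d : R | 0 < d]].

(* sigma_X (A) is the length of the part of the boundary of X that has an outer
   normal angle in A. This is the surface area measure when X is a convex body
   with nonempty interior (it undercounts segments). *)
Definition surface_measure X (A : set (measurableTypeR R)) : \bar R :=
  hausdorff1 (\bigcup_(t in A) edge X t).

Definition surface_abs_cont_on X (I : set (measurableTypeR R)) :=
  (fun A : set (measurableTypeR R) => surface_measure X (A `&` I))
    `<< lebesgue_measure.

(* f is differentiable on [a, b], one-sidedly at the endpoints, with continuous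
   derivative f'. *)
Definition C1_on a b (f f' : R -> R * R) :=
  {within `[a, b], continuous f'} /\
  forall t, t \in `[a, b] ->
    (fun s => (s - t)^-1 *: (f s - f t)) @ within `[a, b] t^' --> f' t.

Definition cap K :=
  [/\ convex_body K, support_fun K (pi / 2) = 1, support_fun K (3 * pi / 2) = 0
    & exists H : set (R * R),
        H `<=` [set h | h.1 \in `[0, pi] \/ h.1 = 3 * pi / 2] /\
        K = \bigcap_(h in H) [set p | dot p (u_ h.1) <= h.2]].

Definition inner_corner K t : R * R :=
  (support_fun K t - 1) *: u_ t + (support_fun K (t + pi / 2) - 1) *: v_ t.

Definition inner_quadrant K t : set (R * R) :=
  [set p | dot p (u_ t) < support_fun K t - 1 /\
           dot p (v_ t) < support_fun K (t + pi / 2) - 1].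

Definition niche K : set (R * R) :=
  [set p | 0 <= p.2] `&` \bigcup_(t in `]0, pi / 2[) inner_quadrant K t.

Definition sofa_area K : R := area K - area (niche K).

Definition injectivity_condition K :=
  [/\ surface_abs_cont_on K `[0, pi / 2[,
      surface_abs_cont_on K `]pi / 2, pi]
    & exists x' : R -> R * R,
        C1_on 0 (pi / 2) (inner_corner K) x' /\
        forall t, t \in `]0, pi / 2[ ->
          dot (x' t) (u_ t) < 0 /\ 0 < dot (x' t) (v_ t)].

Definition Ki K := [/\ cap K, 22 / 10 <= area K & injectivity_condition K].

Definition gerver_constants (p q phi theta : R) :=
  [/\ 0 < phi, phi < theta & theta < pi / 4] /\
  [/\ p * (cos theta - cos phi) - 2 * q * sin phi
        + (theta - phi - 1) * cos theta - sin theta + cos phi + sin phi = 0,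
      p * (3 * sin theta + sin phi) - 2 * q * cos phi
        + 3 * (theta - phi - 1) * sin theta + 3 * cos theta
        - sin phi + cos phi = 0,
      p * cos phi = sin phi + 1 / 2 - 1 / 2 * cos phi + q * sin phi
    & p + pi / 2 - phi - theta
        = q - 1 / 2 * (theta - phi) * (1 + p) - 1 / 4 * (theta - phi) ^+ 2].

(* [phi] stands for phi^R, and [pi / 2 - phi] for phi^L. *)
Definition body_B (phi : R) K : set (R * R) :=
  K `&` \bigcap_(t in `[phi, pi / 2])
          [set p | support_fun K t - 1 <= dot p (u_ t)].

Definition body_D (phi : R) K : set (R * R) :=
  K `&` \bigcap_(t in `[0, pi / 2 - phi])
          [set p | support_fun K (t + pi / 2) - 1 <= dot p (v_ t)].

(* Riemann-Stieltjes integral of f with respect to g on [a, b]: the limit, as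
   the mesh tends to 0, of the sums over the partitions a :: s of [a, b] with
   tags xi. *)
Definition is_RSint a b (f g : R -> R) (I : R) :=
  forall e : R, 0 < e -> exists2 d : R, 0 < d &
    forall (s : seq R) (xi : nat -> R),
      let x := nth b (a :: s) in
      itv_partition a b s ->
      (forall i, (i < size s)%N ->
        [/\ x i <= xi i, xi i <= x i.+1 & x i.+1 - x i < d]) ->
      `| \sum_(0 <= i < size s) f (xi i) * (g (x i.+1) - g (x i)) - I | <= e.

Definition RSint a b (f g : R -> R) : R := xget 0 (is_RSint a b f g).

Definition curve_area a b (z : R -> R * R) : R :=
  (RSint a b (fst \o z) (snd \o z) - RSint a b (snd \o z) (fst \o z)) / 2.

Definition segment_area p q : R := (p.1 * q.2 - p.2 * q.1) / 2.

Definition normal_arc X a b : set (R * R) :=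
  [set v_plus X a] `|` \bigcup_(t in `]a, b[) edge X t `|` [set v_minus X b].

(* z traces the set A exactly once, from p to q; a one-point arc is traced on a
   degenerate interval c = d. *)
Definition traces c d (z : R -> R * R) (A : set (R * R)) p q :=
  [/\ c <= d, {within `[c, d], continuous z} & {in `[c, d] &, injective z}] /\
  [/\ bounded_variation c d (fst \o z), bounded_variation c d (snd \o z),
      z @` `[c, d] = A, z c = p & z d = q].

(* The common curve area of all the parametrizations of the arc. *)
Definition arc_area X a b : R :=
  xget 0 [set J | exists c d z,
    traces c d z (normal_arc X a b) (v_plus X a) (v_minus X b) /\
    J = curve_area c d z].

Definition Qfun (phi : R) K B D : R :=
  let phiL := pi / 2 - phi in
  area K
  + arc_area D (3 * pi / 2) (3 * pi / 2 + phiL)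
  + segment_area (v_minus D (3 * pi / 2 + phiL)) (inner_corner K phiL)
  - curve_area phi phiL (inner_corner K)
  + segment_area (inner_corner K phi) (v_plus B (pi + phi))
  + arc_area B (pi + phi) (3 * pi / 2).

End plane.

(* Main.v *)
Require Import Defs.
From mathcomp Require Import all_boot all_order all_algebra.
From mathcomp Require Import all_classical all_reals all_analysis.
From mathcomp Require Import ring lra.

(** The functional Q is |K| plus the signed areas of the pieces of a closed curve,
   up to segments on the ground line y = 0, which contribute nothing. So the claim is
   that the area of the niche is at least the signed area enclosed by that curve.
   No Jordan curve is needed, because every piece of the curve is a graph over the
   x-axis.

   The derivative of the inner corner x_K(t) lies strictly between the directions
   v_t and -u_t, so x_K moves to the left; both its projection on u_phi and the
   mirror image of that projection are monotone for t in [phi, pi/2 - phi], hence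
   the curve is a Lipschitz graph. The lower left arc of B is the graph of the
   upper envelope, the roof, of the lines p.u_t = h_K(t) - 1 with t in
   [phi, pi/2] ([right_arcE]); the segment from x_K(phi) to this arc lies on the line
   at phi, because B touches that line ([body_B_touches]). The left side is the
   mirror image. For a graph y = G x the curve area is a boundary term minus the
   integral of G ([curve_area_graph]), and the boundary terms telescope around the
   closed curve. The enclosed signed area is therefore the integral of
      (g_R - l_R) + F + (g_L - l_L),
   where g_R and g_L are the two roofs, l_R and l_L the lines at phi and at its mirror
   image, and F is the inner corner curve continued by these lines.

   It remains to bound this integrand by the length of the vertical section of the
   niche ([height_le]). The niche contains the points above the ground that are
   below F, and those between a line and its roof ([niche_under_roof]). The first
   interval lies below the two lines, so the bound follows unless both roofs exceed
   their lines over the same x. But where a roof exceeds its line it is at most 1, the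
   height of K, whereas l_R + l_L >= 2 because the two lines meet at height at least 1.
   This last fact is where the constants enter: the four equations force phi to be
   small ([gerver_phi_small]), and an area of at least 2.2 makes K wide
   ([arch_area_le]). *)

Set Implicit Arguments.
Unset Strict Implicit.
Unset Printing Implicit Defensive.
Import Order.TTheory GRing.Theory Num.Theory.
Import numFieldNormedType.Exports.
Local Open Scope classical_set_scope.
Local Open Scope ring_scope.

(** * Stieltjes integrals along a graph *)

Lemma segment_unif_continuous (R : realType) (c d : R) (x : R -> R) :
  {within `[c, d], continuous x} -> forall e, 0 < e ->
  exists2 r, 0 < r & forall s t, s \in `[c, d] -> t \in `[c, d] ->
    `|s - t| < r -> `|x s - x t| < e.
Proof.
move=> cx e e0.
have /compact_near_coveringP := @segment_compact R c d.
move=> /(_ R (0^'+)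
  (fun r s => s \in `[c, d] -> forall t, t \in `[c, d] -> `|s - t| < r ->
     `|x s - x t| < e)) [].
  move=> s0 /= s0cd.
  have e2 : 0 < e / 2 by lra.
  have /cvgrPdist_lt /(_ _ e2) : x @ within `[c, d] (nbhs s0) --> x s0.
    by have /subspace_continuousP/(_ s0 s0cd) := cx.
  rewrite /= near_withinE => /nbhs_ballP[r /= r0 rP].
  exists (ball s0 (r / 2), [set y | 0 < y < r / 2]) => /=.
    split; first by apply: nbhsx_ballx; lra.
    have r2 : 0 < r / 2 by lra.
    near=> z => /=; apply/andP; split; near: z; [exact: nbhs_right_gt|exact: nbhs_right_lt].
  move=> [s y] /= [ss0 /andP[y0 yr]] scd t tcd st.
  have xs : `|x s0 - x s| < e / 2.
    by apply: rP => //; rewrite /ball /= in ss0 *; rewrite (lt_trans ss0)//; lra.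
  have xt : `|x s0 - x t| < e / 2.
    apply: rP => //; rewrite /ball /= in ss0 *.
    rewrite (le_lt_trans (ler_distD s _ _))//; lra.
  by rewrite (le_lt_trans (ler_distD (x s0) _ _))// [`|x s - _|]distrC; lra.
move=> r /= r0 rP; exists (r / 2); first lra.
move=> s t scd tcd st; apply: (rP (r / 2)) => //=; try lra.
by rewrite /ball /= sub0r normrN gtr0_norm; lra.
Unshelve. all: by end_near. Qed.

(** The Stieltjes integral is a limit over partitions of small mesh; it is unique
   because there are such partitions. *)
Lemma fine_partition (R : realType) (a b r : R) : a <= b -> 0 < r ->
  exists2 s, itv_partition a b s &
  forall i, (i < size s)%N -> nth b (a :: s) i.+1 - nth b (a :: s) i < r.
Proof.
move=> ab r0.
have r2 : 0 < r / 2 by lra.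
have [n] : exists n : nat, b - a <= n%:R * (r / 2).
  exists (Num.truncn ((b - a) / (r / 2))).+1.
  by rewrite -ler_pdivrMr// ltW// truncnS_gt.
elim: n a ab => [|n IH] a ab.
  rewrite mul0r subr_le0 => ba; exists [::] => //.
  by split => //=; apply/eqP/le_anti; rewrite ab ba.
move=> nr; have [br|br] := leP (b - a) (r / 2).
  move: ab; rewrite le_eqVlt => /predU1P[->|ab]; first by exists [::].
  exists [:: b]; first exact: itv_partition1.
  by case=> //= _; lra.
have [||s sp sr] := IH (a + r / 2); [lra| |].
  move: nr; rewrite mulrSr; lra.
exists (a + r / 2 :: s).
  by case: sp => /= sp sb; split => //=; rewrite sp andbT; lra.
by case=> [|i] /=; [move=> _; lra|move=> /sr].
Qed.

Section stieltjes.
Context {R : realType}.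
Implicit Types (a b c d : R) (f g x y G P : R -> R).

Lemma partition_nth_le a b s i : itv_partition a b s -> (i < size s)%N ->
  nth b (a :: s) i <= nth b (a :: s) i.+1.
Proof. by case=> /(pathP b) + _ si => /(_ i si) /ltW. Qed.

Lemma is_RSint_unique a b f g I J : a <= b ->
  is_RSint a b f g I -> is_RSint a b f g J -> I = J.
Proof.
move=> ab fI fJ; apply/eqP; rewrite -subr_eq0 -normr_le0; apply/ler_addgt0Pl => e e0.
have e2 : 0 < e / 2 by lra.
have [r r0 rI] := fI _ e2; have [r' r'0 r'J] := fJ _ e2.
have m0 : 0 < Num.min r r' by rewrite lt_min r0 r'0.
have [s sp ss] := fine_partition ab m0.
pose xi i := nth b (a :: s) i.
have mono i := @partition_nth_le a b s i sp.
rewrite addr0.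
have h1 : `|\sum_(0 <= i < size s) f (xi i) *
   (g (nth b (a :: s) i.+1) - g (nth b (a :: s) i)) - I| <= e / 2.
  apply: (rI s xi sp) => i si; split; [by []|exact: mono|].
  by have := ss _ si; rewrite lt_min => /andP[].
have h2 : `|\sum_(0 <= i < size s) f (xi i) *
   (g (nth b (a :: s) i.+1) - g (nth b (a :: s) i)) - J| <= e / 2.
  apply: (r'J s xi sp) => i si; split; [by []|exact: mono|].
  by have := ss _ si; rewrite lt_min => /andP[].
move: h1 h2; set S := \sum_(_ <= _ < _) _ => h1 h2.
have := ler_distD S I J; rewrite (distrC I S); lra.
Qed.

Lemma RSintE a b f g I : a <= b -> is_RSint a b f g I -> RSint a b f g = I.
Proof.
by move=> ab fI; apply: xget_unique => // J fJ; exact: is_RSint_unique fJ fI.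
Qed.

Definition lipschitz_with k G := forall s t, `|G s - G t| <= k * `|s - t|.

(** For a Lipschitz [G] this says that [P] is a primitive of [G]; the uniform
   second-order error is what makes the increments of [P] comparable with the
   terms of a Stieltjes sum. *)
Definition primitive_of k G P :=
  forall s t, `|P t - P s - G s * (t - s)| <= k * (t - s) ^+ 2.

Lemma telescope_partition a b s f : itv_partition a b s ->
  \sum_(0 <= i < size s) (f (nth b (a :: s) i.+1) - f (nth b (a :: s) i)) =
  f b - f a.
Proof.
move=> ps; rewrite telescope_sumr//.
by rewrite /= (itv_partition_nth_size b ps).
Qed.

Lemma nth_partition_itv a b s i : itv_partition a b s -> (i < (size s).+1)%N ->
  nth b (a :: s) i \in `[a, b].
Proof.
by move=> ps si; rewrite in_itv/= itv_partition_nth_ge// itv_partition_nth_le.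
Qed.

Section graph.
Variables (c d k : R) (x y G P : R -> R).
Hypotheses (cd : c <= d) (k0 : 0 <= k) (xC : {within `[c, d], continuous x})
  (xBV : bounded_variation c d x) (Gk : lipschitz_with k G)
  (GP : primitive_of k G P) (yG : forall t, t \in `[c, d] -> y t = G (x t)).

(** On a fine partition the sums for int y dx differ termwise from the
   increments of [P \o x] by a small multiple of the increments of [x], whose
   absolute values have a bounded sum. *)
Lemma is_RSint_graph_ydx : is_RSint c d y x (P (x d) - P (x c)).
Proof.
move=> e e0; have [V VP] := xBV.
have V0 : 0 <= V.
  have [s ps _] := fine_partition cd ltr01.
  apply: le_trans (VP _ (variations_variation x ps)).
  by rewrite sumr_ge0.
have [e1 e10 e1V] : exists2 e1, 0 < e1 & 2 * k * V * e1 <= e.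
  have D0 : 0 < 2 * k * V + 1 by rewrite ltr_wpDl// !mulr_ge0.
  exists (e / (2 * k * V + 1)); first by rewrite divr_gt0.
  by rewrite mulrCA ler_piMr ?(ltW e0)// ler_pdivrMr//; lra.
have [r r0 rP] := segment_unif_continuous xC e10.
exists r => // s xi /= ps xiP.
rewrite -(telescope_partition (P \o x) ps) -sumrB.
apply: (@le_trans _ _ (\sum_(0 <= i < size s) (2 * k * e1) *
   `|x (nth d (c :: s) i.+1) - x (nth d (c :: s) i)|)); last first.
  rewrite -mulr_sumr.
  have := VP _ (variations_variation x ps); rewrite /variation /= => SV.
  apply: (@le_trans _ _ (2 * k * e1 * V)).
    by apply: ler_wpM2l; [rewrite !mulr_ge0//; exact: ltW|exact: SV].
  by rewrite (_ : 2 * k * e1 * V = 2 * k * V * e1)//; ring.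
apply: le_trans (ler_norm_sum _ _ _) _.
rewrite !big_nat; apply: ler_sum => i /andP[_ si].
have [x1 x2 x3] := xiP _ si.
have ti := nth_partition_itv ps (leqW si).
have ti1 := nth_partition_itv ps (si : (i.+1 < (size s).+1)%N).
have xii : xi i \in `[c, d].
  move: ti ti1; rewrite !in_itv/= => /andP[? ?] /andP[? ?]; apply/andP; split; lra.
rewrite yG//=.
move: ti ti1 x1 x2 x3 => /=; set u := nth d (c :: s) i; set v := nth d s i => ti ti1 x1 x2 x3.
have h1 : `|x (xi i) - x u| < e1 by apply: rP => //; rewrite ger0_norm; lra.
have h2 : `|x v - x u| < e1 by apply: rP => //; rewrite ger0_norm; lra.
have -> : G (x (xi i)) * (x v - x u) - (P (x v) - P (x u)) =
  (G (x (xi i)) - G (x u)) * (x v - x u)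
   - (P (x v) - P (x u) - G (x u) * (x v - x u)) by ring.
apply: le_trans (ler_normB _ _) _.
have -> : 2 * k * e1 * `|x v - x u| = k * e1 * `|x v - x u| + k * (e1 * `|x v - x u|) by ring.
apply: lerD.
  rewrite normrM ler_wpM2r//; apply: le_trans (Gk _ _) _.
  by rewrite ler_wpM2l// ltW.
apply: le_trans (GP _ _) _; rewrite ler_wpM2l// -real_normK ?num_real// expr2.
by rewrite ler_wpM2r// ltW.
Qed.

Lemma is_RSint_graph_xdy :
  is_RSint c d x y (x d * y d - x c * y c - (P (x d) - P (x c))).
Proof.
move=> e e0; have [V VP] := xBV.
have V0 : 0 <= V.
  have [s ps _] := fine_partition cd ltr01.
  apply: le_trans (VP _ (variations_variation x ps)).
  by rewrite sumr_ge0.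
have e2 : 0 < e / 2 by lra.
have [r2 r20 r2P] := is_RSint_graph_ydx e2.
have [e1 e10 e1V] : exists2 e1, 0 < e1 & k * V * e1 <= e / 2.
  have D0 : 0 < k * V + 1 by rewrite ltr_wpDl// !mulr_ge0.
  exists (e / 2 / (k * V + 1)); first by rewrite divr_gt0.
  by rewrite mulrCA ler_piMr ?(ltW e2)// ler_pdivrMr//; lra.
have [r r0 rP] := segment_unif_continuous xC e10.
exists (Num.min r r2); first by rewrite lt_min r0 r20.
move=> s xi /= ps xiP.
(* summation by parts, with the left endpoints as tags for int y dx *)
pose T i := nth d (c :: s) i.
have /= := r2P s T ps _.
have mono i : (i < size s)%N ->
    [/\ T i <= T i, T i <= nth d s i & nth d s i - T i < r2].
  move=> si; have [x1 x2] := xiP _ si; rewrite lt_min => /andP[_ ?]; split => //.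
  exact: le_trans x1 x2.
move=> /(_ mono); set S2 := \sum_(_ <= _ < _) _ => S2P.
set S1 := \sum_(_ <= _ < _) _.
have E : S1 - (x d * y d - x c * y c - (P (x d) - P (x c))) =
   \sum_(0 <= i < size s) (x (xi i) - x (nth d s i)) * (y (nth d s i) - y (T i))
    - (S2 - (P (x d) - P (x c))).
  have := telescope_partition (fun t => x t * y t) ps => <-.
  suff : S1 = \sum_(0 <= i < size s) (x (nth d (c :: s) i.+1) * y (nth d (c :: s) i.+1)
     - x (T i) * y (T i)) - S2 + \sum_(0 <= i < size s)
    (x (xi i) - x (nth d s i)) * (y (nth d s i) - y (T i)) by move=> ->; rewrite /T /=; ring.
  rewrite /S1 /S2 -sumrB -big_split/=; apply: eq_bigr => i _.
  by rewrite /T /=; ring.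
rewrite E; apply: le_trans (ler_normB _ _) _.
have -> : e = e / 2 + e / 2 by lra.
apply: lerD => //.
apply: (@le_trans _ _ (\sum_(0 <= i < size s) (k * e1) *
   `|x (nth d (c :: s) i.+1) - x (nth d (c :: s) i)|)); last first.
  rewrite -mulr_sumr.
  have := VP _ (variations_variation x ps); rewrite /variation /= => SV.
  apply: (@le_trans _ _ (k * e1 * V)).
    by apply: ler_wpM2l; [rewrite !mulr_ge0//; exact: ltW|exact: SV].
  by rewrite (_ : k * e1 * V = k * V * e1)//; ring.
apply: le_trans (ler_norm_sum _ _ _) _.
rewrite !big_nat; apply: ler_sum => i /andP[_ si].
have [x1 x2] := xiP _ si; rewrite lt_min => /andP[x3 _].
have ti := nth_partition_itv ps (leqW si).
have ti1 := nth_partition_itv ps (si : (i.+1 < (size s).+1)%N).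
have xii : xi i \in `[c, d].
  move: ti ti1; rewrite !in_itv/= => /andP[? ?] /andP[? ?]; apply/andP; split; lra.
rewrite /T; move: ti ti1 x1 x2 x3 => /=.
set u := nth d (c :: s) i; set v := nth d s i => ti ti1 x1 x2 x3.
rewrite !yG// normrM mulrC [k * _]mulrC -mulrA mulrC; apply: ler_pM => //.
rewrite ltW//; apply: rP => //; rewrite ler0_norm; lra.
Qed.

End graph.

(** On a graph y = G x the integration by parts formula gives
   int x dy = [x y] - int y dx, and int y dx depends on the endpoints only. *)
Lemma curve_area_graph c d k (z : R -> R * R) G P : c <= d -> 0 <= k ->
  {within `[c, d], continuous (fst \o z)} -> bounded_variation c d (fst \o z) ->
  lipschitz_with k G -> primitive_of k G P ->
  (forall t, t \in `[c, d] -> (z t).2 = G (z t).1) ->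
  curve_area c d z = ((z d).1 * (z d).2 - (z c).1 * (z c).2) / 2
                     - (P (z d).1 - P (z c).1).
Proof.
move=> cd k0 zC zBV Gk GP zG; rewrite /curve_area.
rewrite (RSintE cd (is_RSint_graph_ydx cd k0 zC zBV Gk GP zG)).
rewrite (RSintE cd (is_RSint_graph_xdy cd k0 zC zBV Gk GP zG)) /=; lra.
Qed.

End stieltjes.

(** * Primitives, suprema of Lipschitz functions, and areas *)

Section primitives.
Context {R : realType}.
Implicit Types (a b c d k : R) (G P : R -> R).
Local Notation mu := (@lebesgue_measure R).

Lemma lipschitz_with_continuous k G : lipschitz_with k G -> continuous G.
Proof.
move=> Gk x; apply/cvgrPdist_lt => e e0.
have k1 : 0 < `|k| + 1 by rewrite ltr_wpDl.
near=> t.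
apply: le_lt_trans (Gk _ _) _.
apply: (@le_lt_trans _ _ ((`|k| + 1) * `|x - t|)).
  by rewrite ler_wpM2r// (le_trans (ler_norm k))// lerDl.
rewrite mulrC -ltr_pdivlMr//.
by near: t; apply: cvgr_dist_lt; rewrite ?divr_gt0.
Unshelve. all: by end_near. Qed.

Lemma lipschitz_with_integrable k G a b : lipschitz_with k G ->
  mu.-integrable `[a, b] (EFin \o G).
Proof.
move=> Gk; apply: continuous_compact_integrable; first exact: segment_compact.
exact/continuous_subspaceT/(lipschitz_with_continuous Gk).
Qed.

(** The primitive is the signed integral from 0, so that it is defined on the
   whole line. *)
Lemma lipschitz_primitive k G : lipschitz_with k G ->
  exists2 P, primitive_of k G P &
    forall a b, a <= b -> P b - P a = \int[mu]_(x in `[a, b]) G x.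
Proof.
move=> Gk; have iG a b := lipschitz_with_integrable a b Gk.
have addI a b c : a <= b -> b <= c ->
    \int[mu]_(x in `[a, c]) G x
    = \int[mu]_(x in `[a, b]) G x + \int[mu]_(x in `[b, c]) G x.
  move=> ab bc.
  have ibc : mu.-integrable `]b, c] (EFin \o G).
    by apply: integrableS (iG b c) => //; exact: subset_itv_oc_cc.
  have bcE := @Rintegral_itv_obnd_cbnd R b (BRight c) G ibc.
  have acE := @Rintegral_itvB R G (BLeft a) (BRight c) b (iG a c) ab bc.
  by rewrite -bcE -acE addrC subrK.
pose P x := if 0 <= x then \int[mu]_(t in `[0, x]) G t
            else - \int[mu]_(t in `[x, 0]) G t.
have PB a b : a <= b -> P b - P a = \int[mu]_(x in `[a, b]) G x.
  move=> ab; rewrite /P; case: ifPn => b0; case: ifPn => a0.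
  - by rewrite (addI 0 a b)// addrC addKr.
  - by rewrite opprK addrC (addI a 0 b)// ltW// ltNge.
  - by move: b0; rewrite (le_trans a0 ab).
  - by rewrite opprK addrC (addI a b 0) ?addrK// ltW// ltNge.
exists P => // s t.
have main u v w : u <= v -> w \in `[u, v] ->
    `|\int[mu]_(x in `[u, v]) G x - G w * (v - u)| <= k * (v - u) ^+ 2.
  move=> uv; rewrite in_itv/= => /andP[uw wv].
  have cst_int r : \int[mu]_(x in `[u, v]) r = r * (v - u).
    rewrite Rintegral_cst//= lebesgue_measure_itv/= lte_fin; case: ltP => //= vu.
    by rewrite (_ : v = u) ?subrr//; apply/le_anti; rewrite vu uv.
  have icst r : mu.-integrable `[u, v] (EFin \o cst r).
    apply: (@lipschitz_with_integrable 0) => x y; by rewrite subrr normr0 mul0r.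
  rewrite -cst_int -RintegralB//; last exact: (icst (G w)).
  have iB : mu.-integrable `[u, v] (EFin \o (fun x => G x - G w)).
    by apply: (@lipschitz_with_integrable k) => x y; rewrite opprB addrA subrK; exact: Gk.
  have nB : `|\int[mu]_(x in `[u, v]) (G x - G w)|
      <= \int[mu]_(x in `[u, v]) `|G x - G w| by apply: le_normr_Rintegral.
  apply: le_trans nB _.
  rewrite (_ : k * _ = k * (v - u) * (v - u)); last by rewrite expr2 mulrA.
  rewrite -cst_int; apply: le_Rintegral => //.
  - apply: (@lipschitz_with_integrable k) => x y.
    apply: le_trans (ler_dist_dist _ _) _.
    by rewrite opprB addrA subrK; exact: Gk.
  - exact: icst.
  move=> x /=; rewrite in_itv/= => /andP[ux xv].
  have k0 : 0 <= k * (v - u).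
    by have := le_trans (normr_ge0 _) (Gk v u); rewrite ger0_norm ?subr_ge0.
  apply: le_trans (Gk _ _) _.
  have [uv0|kN] := eqVneq u v.
    have -> : x = w by lra.
    by rewrite subrr normr0 -uv0 subrr mulr0.
  have {kN} vu : 0 < v - u by rewrite subr_gt0 lt_neqAle kN.
  rewrite ler_wpM2l//; first by move: k0; rewrite pmulr_lge0.
  by rewrite ler_norml; apply/andP; split; lra.
have [st|/ltW ts] := leP s t.
  by rewrite PB//; apply: main; rewrite // in_itv/= lexx.
rewrite -normrN (_ : - _ = P s - P t - G s * (s - t)); last by ring.
rewrite PB// (_ : (t - s) ^+ 2 = (s - t) ^+ 2); last by ring.
by apply: main; rewrite // in_itv/= lexx andbT.
Qed.

Lemma lipschitz_withD k k' G G' : lipschitz_with k G -> lipschitz_with k' G' ->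
  lipschitz_with (k + k') (fun x => G x + G' x).
Proof.
move=> Gk G'k s t; rewrite mulrDl opprD addrACA.
exact: le_trans (ler_normD _ _) (lerD (Gk _ _) (G'k _ _)).
Qed.

Lemma lipschitz_withN k G : lipschitz_with k G ->
  lipschitz_with k (fun x => - G x).
Proof. by move=> Gk s t; rewrite -opprD normrN; exact: Gk. Qed.

Definition sup_fun (I : Type) (A : set I) (F : I -> R -> R) x :=
  sup [set F i x | i in A].

Section sup_fun.
Variables (I : Type) (A : set I) (F : I -> R -> R) (k : R).
Hypotheses (A0 : A !=set0) (Fk : forall i, A i -> lipschitz_with k (F i))
  (Fub : forall x, has_ubound [set F i x | i in A]).

Lemma sup_fun_ub i x : A i -> F i x <= sup_fun A F x.
Proof. by move=> Ai; apply: ub_le_sup => //; exists i. Qed.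

Lemma sup_fun_le x r : (forall i, A i -> F i x <= r) -> sup_fun A F x <= r.
Proof.
move=> Fr; apply: ge_sup; last by move=> _ [i Ai <-]; exact: Fr.
by case: A0 => i Ai; exists (F i x), i.
Qed.

Lemma sup_fun_lt x r : r < sup_fun A F x -> exists2 i, A i & r < F i x.
Proof.
move=> rS; apply: contrapT => H; move: rS; rewrite ltNge => /negP; apply.
by apply: sup_fun_le => i Ai; rewrite leNgt; apply/negP => rF; apply: H; exists i.
Qed.

Lemma sup_fun_lipschitz : lipschitz_with k (sup_fun A F).
Proof.
have H x y : sup_fun A F x <= sup_fun A F y + k * `|x - y|.
  apply: sup_fun_le => i Ai.
  have := sup_fun_ub y Ai; have := le_trans (ler_norm _) (Fk Ai x y); lra.
move=> x y; have := H x y; have := H y x; rewrite (distrC y x) => h1 h2.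
by rewrite ler_norml; apply/andP; split; lra.
Qed.

End sup_fun.

End primitives.

(** The integral of a nonnegative function is a supremum over the simple
   functions below it, so monotonicity requires no measurability. *)
Lemma le_integral_nonneg d (T : measurableType d) (R : realType)
    (m : {measure set T -> \bar R}) (f g : T -> \bar R) :
  (forall x, 0 <= f x)%E -> (forall x, f x <= g x)%E ->
  (\int[m]_x f x <= \int[m]_x g x)%E.
Proof.
move=> f0 fg; have g0 x : (0 <= g x)%E by exact: le_trans (f0 x) (fg x).
rewrite !ge0_integralTE//; apply: ereal_sup_le => _ [h /= hf <-].
by exists h => // x; exact: le_trans (hf x) (fg x).
Qed.

Section area.
Context {R : realType}.
Local Notation mu := (@lebesgue_measure R).
Implicit Types (a b c k : R) (S T : set (R * R)).

(** Lebesgue measure is the restriction of an outer measure, so it is monotone on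
   all sets. *)
Lemma le_lebesgue_measure (A B : set R) : A `<=` B -> (mu A <= mu B)%E.
Proof. by move=> AB; exact: le_mu_ext. Qed.

Lemma le_lebesgue_measure2 S T : S `<=` T -> ((mu \x mu) S <= (mu \x mu) T)%E.
Proof.
move=> ST; apply: le_integral_nonneg => x /=; first exact: mu_ext_ge0.
by apply: le_lebesgue_measure => y; rewrite /xsection /= !inE; exact: ST.
Qed.

Lemma lebesgue_measure2_rect a b c d : a <= b -> c <= d ->
  (mu \x mu)%E (`[a, b] `*` `[c, d]) = ((b - a) * (d - c))%:E.
Proof.
move=> ab cd; rewrite product_measure1E//= !lebesgue_measure_itv/= !lte_fin.
have E (x y : R) : x <= y ->
      (if (x < y)%R then y%:E - x%:E else 0)%E = (y - x)%:E :> \bar R.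
  by move=> xy; case: ltP => // yx; rewrite (_ : y = x) ?subrr//; apply/le_anti/andP.
by rewrite !E// EFinM.
Qed.

Lemma area_fin S a b c d : a <= b -> c <= d -> S `<=` `[a, b] `*` `[c, d] ->
  (mu \x mu)%E S \is a fin_num.
Proof.
move=> ab cd Sabcd; rewrite ge0_fin_numE; last first.
  by apply: integral_ge0 => x _; exact: mu_ext_ge0.
by apply: le_lt_trans (le_lebesgue_measure2 Sabcd) _; rewrite lebesgue_measure2_rect// ltry.
Qed.

Lemma area_le_rect S a b c d : a <= b -> c <= d -> S `<=` `[a, b] `*` `[c, d] ->
  area S <= (b - a) * (d - c).
Proof.
move=> ab cd Sabcd; rewrite -lee_fin -lebesgue_measure2_rect// fineK; last first.
  exact: area_fin Sabcd.
exact: le_lebesgue_measure2.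
Qed.

(** Cavalieri's principle, as a lower bound on the area. Boundedness of [S] makes
   its measure finite, without which [area S] would be 0. *)
Lemma area_ge_integral S a b c d l r k (G : R -> R) : a <= b -> c <= d ->
  S `<=` `[a, b] `*` `[c, d] -> lipschitz_with k G ->
  (forall x, x \in `[l, r] -> ((G x)%:E <= mu (xsection S x))%E) ->
  \int[mu]_(x in `[l, r]) G x <= area S.
Proof.
move=> ab cd Sabcd Gk GS; have Sfin := area_fin ab cd Sabcd.
have SE : (area S)%:E = (mu \x mu)%E S by rewrite fineK.
rewrite -lee_fin SE.
pose G0 x := Num.max (G x) 0.
have G0k : lipschitz_with k G0.
  move=> s t; apply: le_trans (Gk s t); rewrite /G0 ler_norml.
  have := ler_norm (G s - G t); have := ler_norm (G t - G s); rewrite distrC => h1 h2.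
  case: (leP (G s) 0) => gs; case: (leP (G t) 0) => gt; apply/andP; split; lra.
have iG := lipschitz_with_integrable l r Gk.
have iG0 := lipschitz_with_integrable l r G0k.
apply: (@le_trans _ _ (\int[mu]_(x in `[l, r]) G0 x)%:E).
  by rewrite lee_fin; apply: le_Rintegral => // x _; rewrite /G0 le_max lexx.
rewrite fineK; last exact: integrable_fin_num.
rewrite integral_mkcond; apply: le_integral_nonneg => x /=.
  by rewrite patchE; case: ifP => // _; rewrite lee_fin /G0 le_max lexx orbT.
rewrite patchE; case: ifPn => [|_]; last exact: mu_ext_ge0.
rewrite inE /= => xlr; rewrite /G0.
have S0 : (0 <= mu (xsection S x))%E by exact: mu_ext_ge0.
by case: (leP (G x) 0) => _; [exact: S0|exact: GS].
Qed.

End area.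

(** * Arcs that are graphs *)

Lemma continuous_within_fst (R : realType) (A : set R) (z : R -> R * R) :
  {within A, continuous z} -> {within A, continuous (fst \o z)}.
Proof. by move=> zC x; apply: (cvg_comp _ _ (zC x)); exact: cvg_fst. Qed.

Lemma lipschitz_bounded_variation (R : realType) (a b k : R) (G : R -> R) :
  lipschitz_with k G -> bounded_variation a b G.
Proof.
move=> Gk; exists (k * (b - a)) => _ [s ps <-].
have := telescope_partition idfun ps => /= <-.
rewrite mulr_sumr /variation !big_nat; apply: ler_sum => i /andP[_ si] /=.
apply: le_trans (Gk _ _) _; rewrite ger0_norm// subr_ge0.
exact: partition_nth_le.
Qed.

(** Every parametrization of a graph has the same curve area, by
   [curve_area_graph], and the parametrization by the abscissa is one of them. *)
Lemma arc_area_graph (R : realType) (X : set (R * R)) (a b l r k : R)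
    (G P : R -> R) : l <= r -> 0 <= k ->
  lipschitz_with k G -> primitive_of k G P ->
  v_plus X a = (l, G l) -> v_minus X b = (r, G r) ->
  normal_arc X a b = [set p | p.1 \in `[l, r] /\ p.2 = G p.1] ->
  arc_area X a b = (r * G r - l * G l) / 2 - (P r - P l).
Proof.
move=> lr k0 Gk GP Xl Xr arcE; apply: xget_unique => /=.
  exists l, r, (fun x => (x, G x)).
  have zC : continuous (fun x => (x, G x) : R * R).
    move=> x; have Gx : {for x, continuous G} by exact: lipschitz_with_continuous Gk x.
    exact: (@cvg_pair _ _ _ (nbhs x) (nbhs x) (nbhs (G x)) _ _ _ id G (@cvg_id _ _) Gx).
  have fstBV : bounded_variation l r (fst \o (fun x => (x, G x))).
    by apply: nondecreasing_bounded_variation.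
  split; last first.
    rewrite (curve_area_graph (k := k) (G := G) (P := P))//=.
    by apply: continuous_subspaceT => x; exact: cvg_id.
  split; split => //.
  - by apply: continuous_subspaceT; exact: zC.
  - by move=> x y _ _ [].
  - exact: lipschitz_bounded_variation Gk.
  - rewrite arcE; apply/seteqP; split=> [_ [x xlr <-]//|[x y] /= [xlr ->]].
    by exists x.
move=> J [c [d [z [[[cd zC _] [z1BV _ zE zc zd]] ->]]]].
rewrite (curve_area_graph (k := k) (G := G) (P := P))//.
- by rewrite zc zd Xl Xr.
- exact: continuous_within_fst.
move=> t tcd.
have : normal_arc X a b (z t) by rewrite -zE; exists t.
by rewrite arcE => -[].
Qed.

(** * The angle phi is small *)

Section pointwise_derivatives.
Context {R : realType}.
Implicit Types (f g : R -> R) (x a b : R).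

Lemma is_deriveD_pw f g x a b : is_derive x 1 f a -> is_derive x 1 g b ->
  is_derive x 1 (fun t => f t + g t) (a + b).
Proof. by move=> fa gb; exact: is_deriveD. Qed.

Lemma is_deriveN_pw f x a : is_derive x 1 f a ->
  is_derive x 1 (fun t => - f t) (- a).
Proof. by move=> fa; exact: is_deriveN. Qed.

Lemma is_deriveM_pw f g x a b : is_derive x 1 f a -> is_derive x 1 g b ->
  is_derive x 1 (fun t => f t * g t) (f x * b + g x * a).
Proof. by move=> fa gb; exact: is_deriveM. Qed.

Lemma is_deriveX_pw f n x a : is_derive x 1 f a ->
  is_derive x 1 (fun t => f t ^+ n) (n%:R * f x ^+ n.-1 * a).
Proof.
move=> fa; rewrite (_ : (fun t => f t ^+ n) = f ^+ n); first exact: is_deriveX.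
by apply/funext => t; rewrite fctE.
Qed.

Lemma is_derive_comp f g x a b : is_derive x 1 f a -> is_derive (f x) 1 g b ->
  is_derive x 1 (fun t => g (f t)) (b * a).
Proof. by move=> fa gb; exact: is_derive1_comp. Qed.

End pointwise_derivatives.

Ltac derive_pw := eapply is_derive_eq; [
  repeat first [exact: is_derive_cst | exact: is_derive_id
    | eassumption
    | refine (is_derive_comp _ (is_derive_sin _))
    | refine (is_derive_comp _ (is_derive_cos _))
    | eapply is_deriveD_pw | eapply is_deriveN_pw
    | eapply is_deriveX_pw | eapply is_deriveM_pw ] | ].

Section trigonometric_bounds.
Context {R : realType}.
Implicit Types (x b : R) (f df : R -> R).

Lemma ge0_of_derive f df b : (forall x, is_derive x 1 f (df x)) ->
  (forall x, 0 <= x <= b -> 0 <= df x) -> 0 <= f 0 ->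
  forall x, 0 <= x <= b -> 0 <= f x.
Proof.
move=> fdf df0 f0 x /andP[x0 xb].
have fC : {within `[0, x], continuous f}.
  apply: continuous_subspaceT => y.
  by apply/differentiable_continuous/derivable1_diffP; case: (fdf y).
have [y] := MVT_segment x0 (fun y _ => fdf y) fC.
rewrite in_itv/= => /andP[y0 yx] E; rewrite -(subrK (f 0) (f x)) E addr_ge0// mulr_ge0 ?subr_ge0//.
by apply: df0; rewrite y0 (le_trans yx).
Qed.

Lemma sin_le_id x : 0 <= x -> sin x <= x.
Proof.
move=> x0; rewrite -subr_ge0.
have D (y : R) : is_derive y (1 : R) (fun x : R => x - sin x)
    ((fun x => 1 - cos x) y) by derive_pw => /=; lra.
apply: (ge0_of_derive (b := x) D).
- by move=> y _; rewrite subr_ge0 cos_le1.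
- by rewrite sin0 subrr.
by rewrite x0 lexx.
Qed.

Lemma cos_ge_taylor2 x : 0 <= x -> 1 - x ^+ 2 / 2 <= cos x.
Proof.
move=> x0; rewrite -subr_ge0.
have D (y : R) : is_derive y (1 : R) (fun x : R => cos x - (1 - x ^+ 2 / 2))
    ((fun x => x - sin x) y) by derive_pw => /=; lra.
apply: (ge0_of_derive (b := x) D).
- by move=> y /andP[y0 _]; rewrite subr_ge0 sin_le_id.
- by rewrite cos0 expr0n /= mul0r subr0 subrr.
by rewrite x0 lexx.
Qed.

Lemma sin_ge_taylor3 x : 0 <= x -> x - x ^+ 3 / 6 <= sin x.
Proof.
move=> x0; rewrite -subr_ge0.
have D (y : R) : is_derive y (1 : R) (fun x : R => sin x - (x - x ^+ 3 / 6))
    ((fun x => cos x - (1 - x ^+ 2 / 2)) y) by derive_pw => /=; lra.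
apply: (ge0_of_derive (b := x) D).
- by move=> y /andP[y0 _]; rewrite subr_ge0 cos_ge_taylor2.
- by rewrite sin0 expr0n /= mul0r !subr0.
by rewrite x0 lexx.
Qed.

Lemma cos_le_taylor4 x : 0 <= x -> cos x <= 1 - x ^+ 2 / 2 + x ^+ 4 / 24.
Proof.
move=> x0; rewrite -subr_ge0.
have D (y : R) : is_derive y (1 : R) (fun x : R => 1 - x ^+ 2 / 2 + x ^+ 4 / 24 - cos x)
    ((fun x => sin x - (x - x ^+ 3 / 6)) y) by derive_pw => /=; lra.
apply: (ge0_of_derive (b := x) D).
- by move=> y /andP[y0 _]; rewrite subr_ge0 sin_ge_taylor3.
- by rewrite cos0 !expr0n /= !mul0r subr0 addr0 subrr.
by rewrite x0 lexx.
Qed.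

Lemma sin_lt_cos x : 0 <= x < pi / 4 -> sin x < cos x.
Proof.
move=> /andP[x0 x4]; have pi0 := @pi_gt0 R.
rewrite (_ : cos x = sin (pi / 2 - x)); last first.
  by rewrite sinB sin_pihalf cos_pihalf; lra.
rewrite ltr_sin ?in_itv/=; first lra.
- by apply/andP; split; lra.
- by apply/andP; split; lra.
Qed.

(** At [x = pi / 4] the bounds [1 - x ^+ 2 / 2 <= cos x = sin x <= x] give
   [x >= sqrt 3 - 1]. *)
Lemma pi_ge_2928 : 2928 / 1000 <= pi :> R.
Proof.
have pi0 := @pi_gt0 R.
have E : cos (pi / 4) = sin (pi / 4) :> R.
  have {1}-> : pi / 4 = pi / 2 - pi / 4 :> R by lra.
  by rewrite cosB sin_pihalf cos_pihalf; lra.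
have h1 : 0 <= pi / 4 :> R by lra.
have := cos_ge_taylor2 h1; have := sin_le_id h1; rewrite E.
set x := pi / 4 in h1 * => s1 s2.
have -> : pi = 4 * x :> R by rewrite /x; lra.
nra.
Qed.

(** The Taylor polynomials that bound [sin] from below and [cos] from above cross
   just before 79/100. *)
Lemma sin_lt_cos_bound x : 0 <= x <= 1 -> sin x < cos x -> x < 79 / 100.
Proof.
move=> /andP[x0 x1].
have := sin_ge_taylor3 x0; have := cos_le_taylor4 x0 => h1 h2 h3.
rewrite ltNge; apply/negP => x79.
have : x - x ^+ 3 / 6 < 1 - x ^+ 2 / 2 + x ^+ 4 / 24 by lra.
apply/negP; rewrite -leNgt.
set y := x - 79 / 100.
have y0 : 0 <= y by rewrite /y; lra.
have y1 : y <= 21 / 100 by rewrite /y; lra.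
have -> : x = y + 79 / 100 by rewrite /y; lra.
nra.
Qed.

End trigonometric_bounds.

Section gerver_angle.
Context {R : realType}.
Implicit Types (p q phi theta d : R).

(** The left-hand side vanishes at [d = 0] and its derivative in [d] is
   [(1 - d) * sin (phi + d)]; the right-hand side is what results from
   [sin (phi + d) <= phi + d]. *)
Lemma gerver_gap_le phi d : 0 <= phi -> 0 <= d <= 1 ->
  cos phi + sin phi - (1 - d) * cos (phi + d) - sin (phi + d) <=
  phi * d + (1 - phi) * d ^+ 2 / 2 - d ^+ 3 / 3.
Proof.
move=> f0 d1; rewrite -subr_ge0.
have D (y : R) : is_derive y (1 : R) (fun d : R => phi * d + (1 - phi) * d ^+ 2 / 2 - d ^+ 3 / 3 -
  (cos phi + sin phi - (1 - d) * cos (phi + d) - sin (phi + d)))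
    ((fun d => (1 - d) * (phi + d - sin (phi + d))) y) by derive_pw => /=; lra.
apply: (ge0_of_derive (b := 1) D) => //.
- move=> y /andP[y0 y1]; rewrite mulr_ge0 ?subr_ge0//.
  by apply: sin_le_id; rewrite addr_ge0.
by rewrite addr0 !expr0n /= !mulr0 !mul0r; lra.
Qed.

(** This inequality and the next one exclude the angles between 95/1000 and
   [pi / 4]; [s] and [c] stand for [sin phi] and for the constant term of [q] as
   an affine function of [p]. *)
Lemma gap_lt_small_angle phi d s c : 95 / 1000 <= phi <= 2 / 10 ->
  0 < d <= 79 / 100 - phi -> phi - phi ^+ 3 / 6 <= s ->
  1464 / 1000 - 2 * phi - d / 2 + d ^+ 2 / 4 <= c ->
  phi * d + (1 - phi) * d ^+ 2 / 2 - d ^+ 3 / 3 < 2 * (c * s).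
Proof.
move=> /andP[f1 f2] /andP[d0 d1] fs dc.
have d2 : d <= 695 / 1000 by lra.
have {}fs : 99 / 100 * phi <= s by apply: le_trans fs; nra.
have h1 : d - d ^+ 2 / 2 <= 454 / 1000 by nra.
have h2 : d ^+ 2 / 2 - d ^+ 3 / 3 <= 13 / 100 by nra.
have {dc} dc : 1237 / 1000 - 2 * phi <= c by apply: le_trans dc; nra.
have h3 : (1237 / 1000 - 2 * phi) * (99 / 100 * phi) <= c * s.
  by apply: ler_pM; [clear - f1 f2; lra|clear - f1; lra|exact: dc|exact: fs].
have h4 : phi * (d - d ^+ 2 / 2) <= phi * (454 / 1000).
  by apply: ler_wpM2l; [clear - f1; lra|exact: h1].
have h5 : 0 <= (phi - 95 / 1000) * (2 / 10 - phi) by apply: mulr_ge0; clear - f1 f2; lra.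
clear - h1 h2 h3 h4 h5 f1 f2; lra.
Qed.

Lemma gap_lt_large_angle phi d s c : 2 / 10 <= phi <= 79 / 100 ->
  0 < d <= 79 / 100 - phi -> phi - phi ^+ 3 / 6 <= s -> 3 / 2 * d <= c ->
  phi * d + (1 - phi) * d ^+ 2 / 2 - d ^+ 3 / 3 < 2 * (c * s).
Proof.
move=> /andP[f1 f2] /andP[d0 d1] fs dc.
have {fs} fs : phi * (5 / 6) <= s by apply: le_trans fs; nra.
have h : 3 / 2 * d * (phi * (5 / 6)) <= c * s.
  by apply: ler_pM; [clear - d0; lra|clear - f1; lra|exact: dc|exact: fs].
have h2 : 0 <= d ^+ 3 by rewrite exprn_ge0// ltW.
have h3 : 0 <= phi * d ^+ 2 by apply: mulr_ge0; [clear - f1; lra|exact: sqr_ge0].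
have h4 : d ^+ 2 <= d * (295 / 100 * phi).
  by rewrite expr2; apply: ler_wpM2l; [exact: ltW|clear - f1 d1; lra].
have h5 : 0 < d * phi by apply: mulr_gt0; [exact: d0|clear - f1; lra].
clear - h h2 h3 h4 h5; lra.
Qed.

(** This is [tan phi * (1 + d / 2) < 1]: as [phi < pi / 4 - d], [tan phi] is less
   than [(1 - tan d) / (1 + tan d)]. *)
Lemma tan_mul_lt1 phi d : 0 < phi -> 0 < d -> phi + d < pi / 4 -> d <= 79 / 100 ->
  0 < cos phi - sin phi * (1 + d / 2).
Proof.
move=> f0 d0 t4 d1.
have pi4 := @pihalf_lt2 R.
have sf0 : 0 < sin phi by apply: sin_gt0_pihalf; clear - f0 d0 t4 pi4; lra.
have sd : 0 < cos d - sin d.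
  by rewrite subr_gt0; apply: sin_lt_cos; clear - f0 d0 t4; lra.
have := sin_lt_cos (x := phi + d); rewrite sinD cosD.
have -> : 0 <= phi + d < pi / 4 by clear - f0 d0 t4; lra.
move=> /(_ isT) st.
have sd3 := sin_ge_taylor3 (ltW d0).
have {sd3} sd0 : 8 / 10 * d <= sin d by apply: le_trans sd3; clear - d0 d1; nra.
have h : sin phi * ((1 + d / 2) * (cos d - sin d)) <= sin phi * (cos d + sin d).
  rewrite ler_pM2l//; have := @cos_le1 R d; clear - sd0 d0; nra.
rewrite -(pmulr_lgt0 _ sd); clear - st h; lra.
Qed.

(** The first equation makes [2 q sin phi] at most the quantity bounded by
   [gerver_gap_le]; the last two give [p >= 0], hence a lower bound on [q]. Together
   they leave only small angles [phi]. *)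
Lemma gerver_phi_small p q phi theta : gerver_constants p q phi theta ->
  phi < 95 / 1000.
Proof.
move=> [[f0 ft t4] [E1 _ E3 E4]].
rewrite ltNge; apply/negP => f95.
have pi3 := @pi_ge_2928 R; have pi4 := @pihalf_lt2 R.
have t1 : theta < 79 / 100.
  apply: sin_lt_cos_bound; first by clear - f0 ft t4 pi4; lra.
  by apply: sin_lt_cos; clear - f0 ft t4; lra.
have [d dE] : exists d, theta = phi + d by exists (theta - phi); rewrite addrC subrK.
subst theta.
have d0 : 0 < d by clear - ft; lra.
have d1 : d <= 79 / 100 - phi by clear - t1; lra.
have sf0 : 0 < sin phi by apply: sin_gt0_pihalf; clear - f0 ft t4; lra.
have sf3 := sin_ge_taylor3 (ltW f0).
have ctct : cos (phi + d) <= cos phi.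
  have m1 : phi + d \in `[0, pi] by rewrite in_itv/=; clear - f0 ft t4; lra.
  have m2 : phi \in `[0, pi] by rewrite in_itv/=; clear - f0 ft t4; lra.
  by rewrite ltW// ltr_cos.
have tanb : 0 < cos phi - sin phi * (1 + d / 2).
  by apply: tan_mul_lt1; [exact: f0|exact: d0|exact: t4|clear - d1 f0; lra].
have [c cE] : exists c, c = pi / 2 - phi - (phi + d) + d / 2 + d ^+ 2 / 4.
  by eexists.
have dd : 0 <= d ^+ 2 by rewrite sqr_ge0.
have c0 : 3 / 2 * d <= c by clear - cE dd t4; lra.
have qE : q = p * (1 + d / 2) + c by clear - cE E4; lra.
have sfc : 0 <= sin phi * (1 + c).
  by apply: mulr_ge0; [exact: ltW|clear - c0 d0; lra].
have cf1 := @cos_le1 R phi.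
have p0 : 0 <= p.
  rewrite -(pmulr_lge0 _ tanb); rewrite qE in E3; clear - E3 sfc cf1; lra.
have qc : c <= q by rewrite qE lerDr; apply: mulr_ge0; [exact: p0|clear - d0; lra].
have pcc : 0 <= p * (cos phi - cos (phi + d)) by rewrite mulr_ge0// subr_ge0.
have d01 : 0 <= d <= 1 by clear - d0 d1 f0; lra.
have := @gerver_gap_le phi d (ltW f0) d01.
have -> : cos phi + sin phi - (1 - d) * cos (phi + d) - sin (phi + d) =
    2 * (q * sin phi) + p * (cos phi - cos (phi + d)) by clear - E1; lra.
have cq : c * sin phi <= q * sin phi by rewrite ler_pM2r.
apply/negP; rewrite -ltNge; apply: (@lt_le_trans _ _ (2 * (c * sin phi))); last first.
  by clear - cq pcc; lra.
have d2 : 0 < d <= 79 / 100 - phi by rewrite d0.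
have [f2|f2] := leP (2 / 10) phi.
  apply: gap_lt_large_angle; [|exact: d2|exact: sf3|exact: c0].
  by clear - d1 d0 f2; lra.
apply: gap_lt_small_angle; [|exact: d2|exact: sf3|]; first by clear - f95 f2; lra.
clear - cE pi3; lra.
Qed.

(** The form in which the smallness of [phi] is used: with an area of at least
   22/10 it makes the line at [phi] and its mirror counterpart meet at height at least 1. *)
Lemma gerver_phi_bound p q phi theta : gerver_constants p q phi theta ->
  2 + 2 * sin phi <= 22 / 10 * cos phi.
Proof.
move=> gc; have f1 := gerver_phi_small gc; case: gc => [[f0 _ _] _].
have := sin_le_id (ltW f0); have := cos_ge_taylor2 (ltW f0); nra.
Qed.

End gerver_angle.

(** * Support functions and edges *)

Section plane_geometry.
Context {R : realType}.
Implicit Types (p q w z : R * R) (X : set (R * R)) (s t a b : R).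

Lemma dotDl p q w : dot (p + q) w = dot p w + dot q w.
Proof. rewrite /dot /=; ring. Qed.

Lemma dotZl a p w : dot (a *: p) w = a * dot p w.
Proof. by rewrite /dot /= /GRing.scale /=; ring. Qed.

Lemma dot_u p t : dot p (u_ t) = p.1 * cos t + p.2 * sin t.
Proof. by []. Qed.

Lemma dot_v p t : dot p (v_ t) = p.2 * cos t - p.1 * sin t.
Proof. by rewrite /dot /=; ring. Qed.

Lemma u_Dpi t : u_ (pi + t) = - u_ t.
Proof. by rewrite /u_ addrC cosDpi sinDpi. Qed.

Lemma v_Dpi t : v_ (pi + t) = - v_ t.
Proof. by rewrite /v_ addrC cosDpi sinDpi. Qed.

Lemma dotNr p w : dot p (- w) = - dot p w.
Proof. by rewrite /dot /=; ring. Qed.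

Lemma u_pihalf : u_ (pi / 2) = (0, 1) :> R * R.
Proof. by rewrite /u_ cos_pihalf sin_pihalf. Qed.

Lemma v_pihalf : v_ (pi / 2) = (- 1, 0) :> R * R.
Proof. by rewrite /v_ cos_pihalf sin_pihalf. Qed.

Lemma pi32E : 3 * pi / 2 = pi + pi / 2 :> R.
Proof. by lra. Qed.

Lemma u_Dpihalf t : u_ (t + pi / 2) = v_ t.
Proof. by rewrite /u_ /v_ cosDpihalf sinDpihalf. Qed.

Lemma dot_u_rot p s t :
  dot p (u_ t) = dot p (u_ s) * cos (t - s) + dot p (v_ s) * sin (t - s).
Proof.
have ct : cos t = cos (t - s) * cos s - sin (t - s) * sin s by rewrite -cosD subrK.
have st : sin t = sin (t - s) * cos s + cos (t - s) * sin s by rewrite -sinD subrK.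
by rewrite !dot_u dot_v ct st; ring.
Qed.

Lemma dot_u_rot_back p s t :
  dot p (u_ s) = dot p (u_ t) * cos (t - s) - dot p (v_ t) * sin (t - s).
Proof.
rewrite (dot_u_rot p t s) -(opprB t s) cosN sinN. ring.
Qed.

Lemma dot_continuous w : continuous (fun p => dot p w).
Proof.
move=> p; rewrite /dot; apply: cvgD; apply: cvgMl.
  exact: cvg_fst.
exact: cvg_snd.
Qed.

Lemma compact_dot_max X w : compact X -> X !=set0 ->
  exists2 p, X p & forall q, X q -> dot q w <= dot p w.
Proof.
move=> cX X0; have [|p Xp pmax] := @compact_EVT_max _ _ (fun p => dot p w) X X0 cX.
  by apply: continuous_subspaceT; exact: dot_continuous.
by exists p; [exact/set_mem|move=> q Xq; apply: pmax; exact/mem_set].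
Qed.

Lemma support_funE X t p : X p -> (forall q, X q -> dot q (u_ t) <= dot p (u_ t)) ->
  support_fun X t = dot p (u_ t).
Proof.
move=> Xp pmax; apply/le_anti/andP; split.
  by apply: ge_sup; [exists (dot p (u_ t)), p|move=> _ [q Xq <-]; exact: pmax].
by apply: ub_le_sup; [exists (dot p (u_ t)) => _ [q Xq <-]; exact: pmax|exists p].
Qed.

Section compact_set.
Variables (X : set (R * R)).
Hypotheses (cX : compact X) (X0 : X !=set0).

Lemma support_attained t : exists2 p, X p &
  dot p (u_ t) = support_fun X t /\
  forall q, X q -> dot q (u_ t) <= support_fun X t.
Proof.
have [p Xp pmax] := compact_dot_max (u_ t) cX X0.
by exists p; rewrite ?(support_funE Xp).
Qed.

Lemma support_ub t p : X p -> dot p (u_ t) <= support_fun X t.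
Proof. by have [q _ [_]] := support_attained t; exact. Qed.

Lemma support_le t r : (forall p, X p -> dot p (u_ t) <= r) ->
  support_fun X t <= r.
Proof. by have [q Xq [<- _]] := support_attained t; exact. Qed.

Lemma edgeP t p :
  edge X t p <-> X p /\ forall q, X q -> dot q (u_ t) <= dot p (u_ t).
Proof.
split=> [[Xp pE]|[Xp pmax]]; split=> //; last by rewrite (support_funE Xp pmax).
by rewrite pE => q; exact: support_ub.
Qed.

Lemma compact_edge t : compact (edge X t).
Proof.
apply: (subclosed_compact _ cX); last by move=> p [].
rewrite (_ : edge X t = X `&` [set p | dot p (u_ t) = support_fun X t])//.
apply: closedI; first exact: (compact_closed (@norm_hausdorff _ _) cX).
apply: (@preimage_closed _ _ (fun p => dot p (u_ t)) [set support_fun X t]).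
  by move=> p _; exact: dot_continuous.
exact: closed_eq.
Qed.

Lemma edge_nonempty t : edge X t !=set0.
Proof. by have [p Xp [pE _]] := support_attained t; exists p. Qed.

Lemma v_plusP t : edge X t (v_plus X t) /\
  forall q, edge X t q -> dot q (v_ t) <= dot (v_plus X t) (v_ t).
Proof.
rewrite /v_plus; apply: (@xgetPex _ _ [set p | edge X t p /\ _]) => /=.
have [p ? ?] := compact_dot_max (v_ t) (@compact_edge t) (edge_nonempty t).
by exists p.
Qed.

Lemma v_minusP t : edge X t (v_minus X t) /\
  forall q, edge X t q -> dot (v_minus X t) (v_ t) <= dot q (v_ t).
Proof.
rewrite /v_minus; apply: (@xgetPex _ _ [set p | edge X t p /\ _]) => /=.
have [p pe pmax] := compact_dot_max (- v_ t) (@compact_edge t) (edge_nonempty t).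
by exists p; split => // q /pmax; rewrite !dotNr lerN2.
Qed.

End compact_set.

Lemma inner_corner_u (X : set (R * R)) t :
  dot (inner_corner X t) (u_ t) = support_fun X t - 1.
Proof.
rewrite dotDl !dotZl !dot_u /=; have := cos2Dsin2 t; rewrite !expr2 => cs.
by rewrite cs; ring.
Qed.

Lemma inner_corner_v (X : set (R * R)) t :
  dot (inner_corner X t) (v_ t) = support_fun X (t + pi / 2) - 1.
Proof.
rewrite dotDl !dotZl !dot_v /=; have := cos2Dsin2 t; rewrite !expr2 => cs.
rewrite (_ : _ - - sin t * sin t = cos t * cos t + sin t * sin t); last by ring.
by rewrite cs; ring.
Qed.

End plane_geometry.

(** * The part of the niche on the right *)

(** The properties of a cap and of its inner corner curve that determine the part
   of the niche to the right of the line of slope -cot phi through the inner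
   corner at [phi]. The left part is treated by applying them to the mirror
   image. *)
Record right_leg (R : realType) (phi : R) (K : set (R * R)) : Prop := RightLeg {
  leg_angle : 0 < phi < pi / 2 ;
  leg_compact : compact K ;
  leg_nonempty : K !=set0 ;
  leg_convex : forall p q l, K p -> K q -> 0 <= l <= 1 -> K (l *: p + (1 - l) *: q) ;
  leg_strip : forall p, K p -> 0 <= p.2 <= 1 ;
  leg_top : support_fun K (pi / 2) = 1 ;
  leg_down : forall p y, K p -> 0 <= y <= p.2 -> K (p.1, y) ;
  leg_contact : exists2 c, K c & dot c (v_ phi) = support_fun K (phi + pi / 2) /\
    dot c (u_ phi) <= support_fun K phi - 1 ;
  leg_corner : forall t, phi <= t < pi / 2 ->
    dot (inner_corner K t) (u_ phi) <= support_fun K phi - 1 }.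

Section right_leg_theory.
Context {R : realType}.
Variables (phi : R) (K : set (R * R)).
Hypothesis KR : right_leg phi K.
Implicit Types (p q z : R * R) (t x y : R).

Let angle := leg_angle KR.
Let cK := leg_compact KR.
Let K0 := leg_nonempty KR.
Local Notation h := (support_fun K).
Local Notation B := (body_B phi K).

(** The ordinate at abscissa [x] of the line [dot p (u_ t) = h t - 1]. *)
Definition leg_line t x := (h t - 1 - x * cos t) / sin t.

(** The lower boundary of the unbounded convex region that lies above all the
   lines with [t] in [[phi, pi / 2]]; the body B is the part of [K] above it. *)
Definition leg_roof := sup_fun `[phi, pi / 2]%classic leg_line.

Definition leg_slope := cos phi / sin phi.

Let angle_itv t : t \in `[phi, pi / 2] ->
  [/\ 0 < sin t, 0 <= cos t, sin phi <= sin t & cos t <= cos phi].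
Proof.
have pi0 := @pi_gt0 R; have /andP[f0 f2] := angle.
rewrite in_itv/= => /andP[t1 t2]; split.
- by apply: sin_gt0_pi; apply/andP; split; lra.
- by apply: cos_ge0_pihalf; apply/andP; split; lra.
- have m1 : phi \in `[- (pi / 2), pi / 2] by rewrite in_itv/=; lra.
  have m2 : t \in `[- (pi / 2), pi / 2] by rewrite in_itv/=; lra.
  by rewrite leNgt ltr_sin// -leNgt.
- have m1 : phi \in `[0, pi] by rewrite in_itv/=; lra.
  have m2 : t \in `[0, pi] by rewrite in_itv/=; lra.
  by rewrite leNgt ltr_cos// -leNgt.
Qed.

Let phi_itv : phi \in `[phi, pi / 2].
Proof. by have /andP[_ /ltW f2] := angle; rewrite in_itv/= lexx. Qed.

Let sphi0 : 0 < sin phi. Proof. by have [] := angle_itv phi_itv. Qed.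
Let cphi0 : 0 <= cos phi. Proof. by have [] := angle_itv phi_itv. Qed.

Lemma leg_slope_ge0 : 0 <= leg_slope.
Proof. by rewrite divr_ge0// ltW. Qed.

Lemma leg_line_le t p : t \in `[phi, pi / 2] ->
  (leg_line t p.1 <= p.2) = (h t - 1 <= dot p (u_ t)).
Proof.
by move=> /angle_itv[st _ _ _]; rewrite ler_pdivrMr// lerBlDl dot_u.
Qed.

Lemma leg_line_gt t p : t \in `[phi, pi / 2] ->
  (p.2 < leg_line t p.1) = (dot p (u_ t) < h t - 1).
Proof. by move=> tI; rewrite !ltNge leg_line_le. Qed.

Lemma leg_line_ge t p : t \in `[phi, pi / 2] ->
  (p.2 <= leg_line t p.1) = (dot p (u_ t) <= h t - 1).
Proof.
by move=> /angle_itv[st _ _ _]; rewrite ler_pdivlMr// lerBrDl dot_u.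
Qed.

Lemma leg_line_lipschitz t : t \in `[phi, pi / 2] ->
  lipschitz_with leg_slope (leg_line t).
Proof.
move=> /angle_itv[st ct s1 c1] x y.
rewrite /leg_line -mulrBl (_ : _ - _ = (y - x) * cos t); last by ring.
rewrite -mulrA normrM mulrC distrC ler_wpM2r// ger0_norm ?divr_ge0 ?(ltW st)//.
by rewrite ler_pM ?invr_ge0 ?(ltW st)// lef_pV2 ?posrE.
Qed.

Lemma leg_line_nonincreasing t x y : t \in `[phi, pi / 2] -> x <= y ->
  leg_line t y <= leg_line t x.
Proof.
move=> /angle_itv[st ct _ _] xy.
by rewrite ler_pM2r ?invr_gt0// lerB// ler_wpM2r.
Qed.

Let trig_lipschitz (f df : R -> R) : (forall x, is_derive x 1 f (df x)) ->
  (forall x, `|df x| <= 1) -> lipschitz_with 1 f.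
Proof.
move=> fdf df1.
have main s t : s <= t -> `|f t - f s| <= 1 * `|t - s|.
  move=> st; have fC : {within `[s, t], continuous f}.
    apply: continuous_subspaceT => y.
    by apply/differentiable_continuous/derivable1_diffP; case: (fdf y).
  have [y _ ->] := MVT_segment st (fun y _ => fdf y) fC.
  by rewrite normrM ler_wpM2r.
move=> s t; case: (leP s t) => [st|/ltW ts]; last exact: main.
by rewrite distrC (distrC s); exact: main.
Qed.

Lemma support_fun_lipschitz : exists k, lipschitz_with k h.
Proof.
have cL : lipschitz_with 1 (@cos R).
  by apply: (trig_lipschitz (@is_derive_cos R)) => x; rewrite normrN sin_max.
have sL : lipschitz_with 1 (@sin R).
  by apply: (trig_lipschitz (@is_derive_sin R)) => x; exact: cos_max.
have [p1 _ p1P] := compact_dot_max (1, 0) cK K0.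
have [p2 _ p2P] := compact_dot_max (-1, 0) cK K0.
pose M := `|p1.1| + `|p2.1|.
have KM p : K p -> `|p.1| <= M.
  move=> Kp; have := p1P _ Kp; have := p2P _ Kp; rewrite /dot /= => h1 h2.
  rewrite /M; have := ler_norm p1.1; have := ler_norm (- p2.1); rewrite normrN => h3 h4.
  have := normr_ge0 p1.1; have := normr_ge0 p2.1 => h5 h6.
  by rewrite ler_norml; apply/andP; split; lra.
exists (M + 1) => s t.
have -> : h = sup_fun K (fun p t => dot p (u_ t)) by [].
apply: sup_fun_lipschitz => //.
- move=> p Kp x y; rewrite !dot_u.
  rewrite (_ : _ - _ = p.1 * (cos x - cos y) + p.2 * (sin x - sin y)); last by ring.
  apply: le_trans (ler_normD _ _) _; rewrite !normrM mulrDl.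
  have /andP[p0 p1'] := leg_strip KR Kp.
  apply: lerD; first by apply: ler_pM => //; [exact: KM|have := cL x y; rewrite mul1r].
  apply: ler_pM => //; first by rewrite ger0_norm.
  by have := sL x y; rewrite mul1r.
- by move=> x; exists (h x) => _ [p Kp <-]; exact: support_ub.
Qed.

(** The lines depend continuously on [t], because the support function is
   Lipschitz. *)
Lemma leg_roof_attained x : exists2 t, t \in `[phi, pi / 2] &
  forall s, s \in `[phi, pi / 2] -> leg_line s x <= leg_line t x.
Proof.
have /andP[_ /ltW f2] := angle.
have [k hk] := support_fun_lipschitz.
have LC : {within `[phi, pi / 2], continuous (fun t => leg_line t x)}.
  apply: continuous_in_subspaceT => t /set_mem tI.
  have [st _ _ _] := angle_itv tI.
  apply: cvgM.
    apply: cvgB; first by apply: cvgB; [exact: (lipschitz_with_continuous hk)|exact: cvg_cst].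
    by apply: cvgM; [exact: cvg_cst|exact: continuous_cos].
  by apply: cvgV; [rewrite gt_eqF|exact: continuous_sin].
have [t tI tmax] := EVT_max f2 LC.
by exists t => // s sI; apply: tmax.
Qed.

Let roof_ub x : has_ubound [set leg_line t x | t in `[phi, pi / 2]%classic].
Proof.
by have [t tI tmax] := leg_roof_attained x; exists (leg_line t x) => _ [s sI <-]; exact: tmax.
Qed.

Let itv0 : `[phi, pi / 2]%classic !=set0.
Proof. by exists phi; exact: phi_itv. Qed.

Lemma leg_roof_lipschitz : lipschitz_with leg_slope leg_roof.
Proof.
by apply: sup_fun_lipschitz => // t tI; exact: leg_line_lipschitz.
Qed.

Lemma leg_line_le_roof t x : t \in `[phi, pi / 2] -> leg_line t x <= leg_roof x.
Proof. by move=> tI; exact: sup_fun_ub. Qed.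

Lemma leg_roof_le x y : (forall t, t \in `[phi, pi / 2] -> leg_line t x <= y) ->
  leg_roof x <= y.
Proof. by move=> H; exact: sup_fun_le. Qed.

Lemma leg_line_top x : leg_line (pi / 2) x = 0.
Proof.
by rewrite /leg_line (leg_top KR) cos_pihalf sin_pihalf; lra.
Qed.

Let top_itv : pi / 2 \in `[phi, pi / 2].
Proof. by have /andP[_ /ltW f2] := angle; rewrite in_itv/= lexx andbT. Qed.

Lemma leg_roof_ge0 x : 0 <= leg_roof x.
Proof. by rewrite -(leg_line_top x) leg_line_le_roof. Qed.

Lemma leg_roof_nonincreasing x y : x <= y -> leg_roof y <= leg_roof x.
Proof.
move=> xy; apply: leg_roof_le => t tI.
exact: le_trans (leg_line_nonincreasing tI xy) (leg_line_le_roof _ tI).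
Qed.

Lemma body_B_roofP p : B p <-> K p /\ leg_roof p.1 <= p.2.
Proof.
split=> [[Kp Bp]|[Kp pr]]; split=> //.
  by apply: leg_roof_le => t tI; rewrite leg_line_le//; exact: Bp.
by move=> t tI /=; rewrite -leg_line_le//; exact: le_trans (leg_line_le_roof _ tI) pr.
Qed.

Lemma compact_body_B : compact B.
Proof.
apply: (subclosed_compact _ cK); last by move=> p [].
apply: closedI; first exact: (compact_closed (@norm_hausdorff _ _) cK).
apply: closed_bigI => t _.
apply: (@preimage_closed _ _ (fun p => dot p (u_ t)) [set y | h t - 1 <= y]).
  by move=> p _; exact: dot_continuous.
exact: closed_ge.
Qed.

(** The point [p] of [K] on the line at [phi] that is extreme in direction [v_ phi]
   satisfies all the other constraints: [dot z (u_ t)] exceeds [dot p (u_ t)] by at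
   most 1 for every [z] in [K]. In the one case where no width bound applies, the
   segment from [z] to the contact point at [phi + pi / 2] would meet the line at
   [phi] beyond [p]. *)
Lemma body_B_touches : exists2 p, B p & dot p (u_ phi) = h phi - 1.
Proof.
have [c Kc [cv cu]] := leg_contact KR.
have [a Ka [au _]] := support_attained cK K0 phi.
have cross z w : K z -> K w -> dot z (u_ phi) <= h phi - 1 -> h phi - 1 < dot w (u_ phi) ->
    exists2 m, K m & dot m (u_ phi) = h phi - 1 /\
      Num.min (dot z (v_ phi)) (dot w (v_ phi)) <= dot m (v_ phi).
  move=> Kz Kw zu wu.
  pose l := (dot w (u_ phi) - (h phi - 1)) / (dot w (u_ phi) - dot z (u_ phi)).
  have D0 : 0 < dot w (u_ phi) - dot z (u_ phi) by lra.
  have l01 : 0 <= l <= 1.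
    by rewrite divr_ge0 ?ler_pdivrMr//; lra.
  exists (l *: z + (1 - l) *: w); first exact: (leg_convex KR).
  have lE : l * (dot w (u_ phi) - dot z (u_ phi)) = dot w (u_ phi) - (h phi - 1).
    by rewrite mulfVK// gt_eqF.
  rewrite !dotDl !dotZl; split; first by lra.
  have /andP[l0 l1] := l01.
  rewrite -[leLHS]mul1r -[X in X * _](subrKC l 1) mulrDl.
  by apply: lerD; apply: ler_wpM2l; rewrite ?subr_ge0// ge_min lexx ?orbT.
pose L := K `&` [set p | dot p (u_ phi) = h phi - 1].
have cL : compact L.
  apply: (subclosed_compact _ cK); last by move=> p [].
  apply: closedI; first exact: (compact_closed (@norm_hausdorff _ _) cK).
  apply: (@preimage_closed _ _ (fun p => dot p (u_ phi)) [set h phi - 1]).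
    by move=> p _; exact: dot_continuous.
  exact: closed_eq.
have L0 : L !=set0.
  have [|m Km [mE _]] := cross c a Kc Ka cu; last by exists m.
  by rewrite au; lra.
have [p [Kp pu] pmax] := compact_dot_max (v_ phi) cL L0.
exists p => //; split=> // t tI /=.
have [st ct s1 c1] := angle_itv tI.
have [z Kz [<- _]] := support_attained cK K0 t.
have /andP[p0 p1] := leg_strip KR Kp; have /andP[z0 z1] := leg_strip KR Kz.
have zu := support_ub cK K0 phi Kz.
have zv := support_ub cK K0 (phi + pi / 2) Kz; rewrite u_Dpihalf -cv in zv.
have /andP[f0 f2] := angle; have pi0 := @pi_gt0 R.
have /andP[t1 t2] : phi <= t <= pi / 2 by move: tI; rewrite /= in_itv.
have c0 : 0 <= cos (t - phi) by apply: cos_ge0_pihalf; lra.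
have s0 : 0 <= sin (t - phi) by apply: sin_ge0_pi; lra.
have c1' := @cos_le1 R (t - phi); have s1' := @sin_le1 R t.
(* [z] is no higher than [p] in direction [v_ phi]: use [h phi] *)
have [zp|zp] := leP (dot z (v_ phi)) (dot p (v_ phi)).
  rewrite (dot_u_rot z phi t) (dot_u_rot p phi t) pu.
  have e1 : dot z (v_ phi) * sin (t - phi) <= dot p (v_ phi) * sin (t - phi).
    by rewrite ler_wpM2r.
  have e2 : (dot z (u_ phi) - (h phi - 1)) * cos (t - phi) <= 1 * cos (t - phi).
    by rewrite ler_wpM2r//; lra.
  by lra.
(* [z] is above [p] and to its left: use the height of the strip *)
have [zl|zr] := leP (dot z (u_ phi)) (h phi - 1).
  have z1p1 : z.1 <= p.1.
    have E q : q.1 = dot q (u_ phi) * cos phi - dot q (v_ phi) * sin phi.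
      rewrite dot_u dot_v; have := cos2Dsin2 phi => cs.
      by rewrite -[LHS]mulr1 -cs; ring.
    rewrite (E z) (E p) pu lerB//; first by rewrite ler_wpM2r.
    by rewrite ler_wpM2r// ltW// ltW.
  rewrite !dot_u.
  have e1 : z.1 * cos t <= p.1 * cos t by rewrite ler_wpM2r.
  have e2 : (z.2 - p.2) * sin t <= 1 * sin t by rewrite ler_wpM2r ?(ltW st)//; lra.
  by lra.
have [m Km [mE]] := cross c z Kc Kz cu zr.
rewrite (min_idPr zv) => zm.
by have := le_lt_trans (le_trans zm (pmax m (conj Km mE))) zp; rewrite ltxx.
Qed.

(** The rightmost ground point [(e.1, 0)] of [K] lies above every line, since
   [h t <= e.1 * cos t + sin t]. *)
Lemma body_B_ground : exists2 p, B p & p.2 = 0.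
Proof.
have [e Ke emax] := compact_dot_max (1, 0) cK K0.
have /andP[e0 e1] := leg_strip KR Ke.
exists (e.1, 0) => //; split; first by apply: (leg_down KR); rewrite // lexx.
move=> t tI /=; have [st ct _ _] := angle_itv tI.
rewrite lerBlDr; apply: (support_le cK K0) => p Kp.
have /andP[p0 p1] := leg_strip KR Kp.
have := emax _ Kp; rewrite /dot /= => pe.
have := @sin_le1 R t => s1.
have h1 : p.1 * cos t <= e.1 * cos t by rewrite ler_wpM2r//; lra.
have h2 : p.2 * sin t <= 1 * sin t by rewrite ler_wpM2r// ltW.
by lra.
Qed.

End right_leg_theory.

Section right_leg_arc.
Context {R : realType}.
Variables (phi : R) (K : set (R * R)).
Hypothesis KR : right_leg phi K.
Implicit Types (p q z : R * R) (t x y : R).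

Let angle := leg_angle KR.
Let cK := leg_compact KR.
Let K0 := leg_nonempty KR.
Local Notation h := (support_fun K).
Local Notation B := (body_B phi K).
Local Notation line := (leg_line K).
Local Notation roof := (leg_roof phi K).
Local Notation itv := (`[phi, pi / 2]).

Let phi_in : phi \in itv.
Proof. by have /andP[_ /ltW f2] := angle; rewrite in_itv/= lexx. Qed.

Let sphi0 : 0 < sin phi.
Proof.
have /andP[f0 f2] := angle; have pi0 := @pi_gt0 R.
by apply: sin_gt0_pi; apply/andP; split; lra.
Qed.

Let cphi0 : 0 < cos phi.
Proof.
have /andP[f0 f2] := angle; have pi0 := @pi_gt0 R.
by apply: cos_gt0_pihalf; apply/andP; split; lra.
Qed.

Let cB : compact B := compact_body_B KR.

Let B0 : B !=set0.
Proof. by have [p Bp _] := body_B_ground KR; exists p. Qed.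

(* [X] and [W] are characterized rather than chosen, so that the mirror images of
   the endpoints of the left arc can be substituted for them. *)
Section vertices.
Variables X W : R * R.
Hypotheses
  (Xedge : edge B (pi + phi) X)
  (Xlow : forall q, edge B (pi + phi) q ->
     dot q (v_ (pi + phi)) <= dot X (v_ (pi + phi)))
  (Wedge : edge B (3 * pi / 2) W)
  (Wleft : forall q, edge B (3 * pi / 2) q ->
     dot W (v_ (3 * pi / 2)) <= dot q (v_ (3 * pi / 2))).

Let BX : B X. Proof. by case: Xedge. Qed.
Let BW : B W. Proof. by case: Wedge. Qed.

Lemma arc_start_on_line : dot X (u_ phi) = h phi - 1.
Proof.
have [_ Xmin] := (edgeP cB B0 _ _).1 Xedge.
have [p Bp pE] := body_B_touches KR.
apply/le_anti/andP; split.
  by have := Xmin _ Bp; rewrite u_Dpi !dotNr lerN2 pE.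
by case: BX => _; apply; exact: phi_in.
Qed.

Lemma arc_start_lowest q : B q -> dot q (u_ phi) = h phi - 1 ->
  dot X (v_ phi) <= dot q (v_ phi).
Proof.
move=> Bq qE; have := Xlow; move/(_ q); rewrite v_Dpi !dotNr lerN2; apply.
apply/(edgeP cB B0); split=> // r [_ Br].
by rewrite u_Dpi !dotNr lerN2 qE; apply: Br; exact: phi_in.
Qed.

Lemma arc_end_on_ground : W.2 = 0.
Proof.
have [_ Wmin] := (edgeP cB B0 _ _).1 Wedge.
have [p Bp pE] := body_B_ground KR.
have := Wmin _ Bp; rewrite pi32E u_Dpi u_pihalf !dotNr /dot /= pE => W0.
have [KW _] := BW; have /andP[W1 _] := leg_strip KR KW.
by apply/le_anti/andP; split => //; lra.
Qed.

Lemma arc_end_leftmost q : B q -> q.2 = 0 -> W.1 <= q.1.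
Proof.
move=> Bq q0; have := Wleft; move/(_ q).
rewrite pi32E v_Dpi v_pihalf !dotNr /dot /= !mulr0 !addr0 !mulrN1 !opprK; apply.
apply/(edgeP cB B0); split=> // r [Kr _]; have /andP[r0 _] := leg_strip KR Kr.
by rewrite u_Dpi u_pihalf !dotNr /dot /= q0; lra.
Qed.

Lemma arc_start_roof : X.2 = roof X.1 /\ line phi X.1 = roof X.1.
Proof.
have [_ Xr] := (body_B_roofP KR X).1 BX.
have lX : line phi X.1 = X.2.
  apply/le_anti; rewrite (leg_line_le KR X)// arc_start_on_line lexx /=.
  by rewrite (leg_line_ge KR X)// arc_start_on_line.
have := leg_line_le_roof KR X.1 phi_in; rewrite lX => h1.
have -> : X.2 = roof X.1 by apply/le_anti/andP.
by [].
Qed.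

Lemma arc_end_roof : roof W.1 = 0.
Proof.
have [_ Wr] := (body_B_roofP KR W).1 BW; rewrite arc_end_on_ground in Wr.
by apply/le_anti; rewrite Wr (leg_roof_ge0 KR).
Qed.

(** To the left of [X] the line at [phi] dominates: it does at [X], and it is the
   steepest. *)
Lemma roof_left_of_arc x : x <= X.1 -> roof x = line phi x.
Proof.
move=> xX; apply/le_anti; rewrite (leg_line_le_roof KR)// andbT.
apply: (leg_roof_le KR) => t tI.
have [_ lX] := arc_start_roof.
have := leg_line_le_roof KR X.1 tI; rewrite -lX => tX.
have /andP[f0 f2] := angle; have pi0 := @pi_gt0 R.
move: (tI); rewrite in_itv/= => /andP[t1 t2].
have st : 0 < sin t by apply: sin_gt0_pi; apply/andP; split; lra.
have cot : cos t / sin t <= cos phi / sin phi.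
  rewrite ler_pdivrMr// mulrAC ler_pdivlMr// -subr_ge0.
  rewrite (_ : _ - _ = sin (t - phi)); last by rewrite sinB; ring.
  by apply: sin_ge0_pi; apply/andP; split; lra.
have E s : line s x = line s X.1 + (X.1 - x) * (cos s / sin s).
  by rewrite /leg_line; ring.
by rewrite !E lerD// ler_wpM2l// subr_ge0.
Qed.

Lemma roof_right_of_arc x : W.1 <= x -> roof x = 0.
Proof.
move=> Wx; apply/le_anti; rewrite (leg_roof_ge0 KR) andbT -arc_end_roof.
exact: leg_roof_nonincreasing.
Qed.

Lemma arc_start_le_end : X.1 <= W.1.
Proof.
have WB : h phi - 1 <= dot W (u_ phi) by case: BW => _; apply; exact: phi_in.
have [KX _] := BX; have /andP[X0 _] := leg_strip KR KX.
move: WB; rewrite -arc_start_on_line !dot_u arc_end_on_ground mul0r addr0 => XW.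
have : X.1 * cos phi <= W.1 * cos phi.
  by apply: le_trans XW; rewrite lerDl mulr_ge0// ltW.
by rewrite ler_pM2r.
Qed.

(** This happens only to the right of [X], where the roof is no higher than at [X],
   which is a point of [K]. *)
Lemma roof_le1 x : line phi x < roof x -> roof x <= 1.
Proof.
move=> lr; have [xX|/ltW Xx] := leP x X.1.
  by move: lr; rewrite roof_left_of_arc// ltxx.
apply: le_trans (leg_roof_nonincreasing KR Xx) _.
have [<- _] := arc_start_roof; have [KX _] := BX.
by have /andP[] := leg_strip KR KX.
Qed.

(** Below the chord from [X] to [W], a segment of [K], the set [K] is closed
   downwards. *)
Lemma roof_in_body x : X.1 <= x <= W.1 -> B (x, roof x).
Proof.
move=> /andP[Xx xW].
have [XW|/eqP XW] := eqVneq X.1 W.1.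
  have -> : x = X.1 by lra.
  by have [<- _] := arc_start_roof; rewrite -surjective_pairing.
pose l := (W.1 - x) / (W.1 - X.1).
have D0 : 0 < W.1 - X.1.
  by rewrite subr_gt0 lt_neqAle arc_start_le_end andbT; apply/eqP.
have l01 : 0 <= l <= 1 by rewrite divr_ge0 ?ler_pdivrMr//; lra.
have /andP[l0 l1] := l01.
have lE : l * (W.1 - X.1) = W.1 - x by rewrite mulfVK// gt_eqF.
pose c := l *: X + (1 - l) *: W.
have [KX BX'] := BX; have [KW BW'] := BW.
have Kc : K c by exact: (leg_convex KR).
have Bc : B c.
  split=> // t tI /=; rewrite dotDl !dotZl.
  rewrite -[leLHS]mul1r -[X in X * _](subrKC l 1) mulrDl.
  by apply: lerD; apply: ler_wpM2l; rewrite ?subr_ge0//; [exact: BX'|exact: BW'].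
have c1 : c.1 = x by rewrite /c /= /GRing.scale /=; lra.
have [_] := (body_B_roofP KR c).1 Bc; rewrite c1 => rc.
apply/(body_B_roofP KR); split => //=.
rewrite -c1; apply: (leg_down KR) => //.
by rewrite (leg_roof_ge0 KR) c1.
Qed.

(** A point of the arc minimizes some [dot _ (u_ s)] over the body B, hence cannot be
   lowered: it is on the roof. Conversely the line that attains the roof at [x]
   supports the body B; if it is one of the two extreme lines, the point is an endpoint
   of the arc. *)
Lemma right_arcE :
  [set X] `|` \bigcup_(t in `]pi + phi, 3 * pi / 2[) edge B t `|` [set W] =
  [set p | p.1 \in `[X.1, W.1] /\ p.2 = roof p.1].
Proof.
have /andP[f0 f2] := angle; have pi0 := @pi_gt0 R.
have XW := arc_start_le_end.
apply/seteqP; split=> [p|p /= []].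
  move=> [[->|[t]]|->] /=.
  - by rewrite in_itv/= lexx; have [] := arc_start_roof.
  - rewrite in_itv/= => /andP[t1 t2] /(edgeP cB B0)[Bp pmin].
    pose s := t - pi; have tE : t = pi + s by rewrite /s addrC subrK.
    have {pmin} pmin q : B q -> dot p (u_ s) <= dot q (u_ s).
      by move=> /pmin; rewrite tE u_Dpi !dotNr lerN2.
    have s1 : phi < s by rewrite /s; lra.
    have s2 : s < pi / 2 by rewrite /s; lra.
    have ss : 0 < sin s by apply: sin_gt0_pi; apply/andP; split; lra.
    have cs : 0 < cos s by apply: cos_gt0_pihalf; apply/andP; split; lra.
    have [Kp Bp'] := Bp; have /andP[p0 _] := leg_strip KR Kp.
    have pW : p.1 <= W.1.
      have := pmin _ BW; rewrite !dot_u arc_end_on_ground mul0r addr0 => pW.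
      rewrite -(ler_pM2r cs); apply: le_trans pW.
      by rewrite lerDl mulr_ge0// ltW.
    have Xp : X.1 <= p.1.
      have h1 := pmin _ BX; have h2 : dot X (u_ phi) <= dot p (u_ phi).
        by rewrite arc_start_on_line; apply: Bp'; exact: phi_in.
      have h3 : dot X (u_ phi) * sin s <= dot p (u_ phi) * sin s by rewrite ler_pM2r.
      have h4 : dot p (u_ s) * sin phi <= dot X (u_ s) * sin phi by rewrite ler_pM2r.
      have sd : 0 < sin (s - phi) by apply: sin_gt0_pi; apply/andP; split; lra.
      rewrite -(ler_pM2r sd) sinB; move: h3 h4; rewrite !dot_u; lra.
    have px : X.1 <= p.1 <= W.1 by rewrite Xp pW.
    rewrite in_itv/= px; split=> //.
    have [_ rp] := (body_B_roofP KR p).1 Bp.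
    apply/le_anti; rewrite rp andbT.
    have := pmin _ (roof_in_body px); rewrite !dot_u /= lerD2l.
    by rewrite ler_pM2r.
  - rewrite in_itv/= lexx XW arc_end_roof arc_end_on_ground; split=> //.
case: p => x y /=; rewrite in_itv/= => xXW ->.
have Bx := roof_in_body xXW; have /andP[Xx xW] := xXW.
have [xX|xX] := eqVneq x X.1.
  by left; left; rewrite xX; have [<- _] := arc_start_roof; rewrite /= -surjective_pairing.
have [xW'|xW'] := eqVneq x W.1.
  by right; rewrite xW' arc_end_roof -arc_end_on_ground /= -surjective_pairing.
left; right.
have [t tI tmax] := leg_roof_attained KR x.
have rE : roof x = line t x.
  by apply/le_anti; rewrite (leg_line_le_roof KR)// andbT; exact: leg_roof_le.
have xE : dot (x, roof x) (u_ t) = h t - 1.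
  apply/le_anti; rewrite -(leg_line_ge KR (x, roof x))//.
  by rewrite -(leg_line_le KR (x, roof x))//= -rE lexx.
move: (tI); rewrite in_itv/= => /andP[]; rewrite le_eqVlt => /predU1P[tf|ft].
  (* tight at [phi]: [X] is the lowest point of the body B on that line *)
  rewrite -tf in xE.
  have vE := arc_start_lowest Bx xE.
  have uE : dot X (u_ phi) = dot (x, roof x) (u_ phi) by rewrite arc_start_on_line xE.
  have E q : q.1 = dot q (u_ phi) * cos phi - dot q (v_ phi) * sin phi.
    by rewrite dot_u dot_v; have := cos2Dsin2 phi => cs; rewrite -[LHS]mulr1 -cs; ring.
  exfalso; move/negP: xX; apply; apply/eqP/le_anti; rewrite Xx andbT.
  by rewrite [leLHS](E (x, roof x)) [leRHS]E uE lerD2l lerN2 ler_wpM2r ?(ltW sphi0).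
rewrite le_eqVlt => /predU1P[tp|tp].
  have r0 : roof x = 0 by rewrite rE tp (leg_line_top KR).
  have := arc_end_leftmost Bx r0 => /= Wx.
  by exfalso; move/negP: xW'; apply; apply/eqP/le_anti/andP.
exists (pi + t); first by rewrite /= in_itv/=; lra.
apply/(edgeP cB B0); split=> // q [_ Bq].
by rewrite u_Dpi !dotNr lerN2 xE; exact: Bq.
Qed.

End vertices.

(** A point under the roof is left of the line at some [t], and if it were not below the
   other line through the inner corner at [t], that corner would be to the right
   of the line at [phi]. *)
Lemma niche_under_roof p : 0 <= p.2 -> line phi p.1 <= p.2 -> p.2 < roof p.1 ->
  niche K p.
Proof.
move=> p0; rewrite (leg_line_le KR)// => pphi pr.
have /andP[f0 f2] := angle; have pi0 := @pi_gt0 R.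
have itv0 : `[phi, pi / 2]%classic !=set0 by exists phi; exact: phi_in.
have [t /= tI pt] := sup_fun_lt itv0 pr.
have tp : t != pi / 2.
  by apply/eqP => tE; move: pt; rewrite tE (leg_line_top KR) ltNge p0.
move: pt; rewrite (leg_line_gt KR)// => pt.
move: (tI); rewrite in_itv/= => /andP[t1 t2].
have {tp} t3 : t < pi / 2 by rewrite lt_neqAle tp.
split => //; exists t; first by rewrite /= in_itv/=; lra.
split => //; rewrite ltNge; apply/negP => pv.
have : dot (inner_corner K t) (u_ phi) <= h phi - 1.
  by apply: (leg_corner KR); rewrite t1.
rewrite (dot_u_rot_back _ phi t) inner_corner_u inner_corner_v => hc.
move: pphi; rewrite (dot_u_rot_back p phi t) => pphi.
have ct : 0 < cos (t - phi) by apply: cos_gt0_pihalf; lra.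
have st : 0 <= sin (t - phi) by apply: sin_ge0_pi; lra.
have e1 : dot p (u_ t) * cos (t - phi) < (h t - 1) * cos (t - phi) by rewrite ltr_pM2r.
have e2 : (h (t + pi / 2) - 1) * sin (t - phi) <= dot p (v_ t) * sin (t - phi).
  by rewrite ler_wpM2r.
lra.
Qed.

(** A point below the line at [phi] and not left of the inner corner is lower than
   that corner, so it is also below the other line through it. *)
Lemma niche_right_of_corner p : 0 <= p.2 -> (inner_corner K phi).1 <= p.1 ->
  p.2 < line phi p.1 -> niche K p.
Proof.
move=> p0 cp; rewrite (leg_line_gt KR)// => pphi.
have /andP[f0 f2] := angle.
split => //; exists phi; first by rewrite /= in_itv/=; lra.
split => //; rewrite -inner_corner_v.
move: pphi; rewrite -inner_corner_u !dot_u !dot_v => pphi.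
have e1 : (inner_corner K phi).1 * cos phi <= p.1 * cos phi by rewrite ler_wpM2r// ltW.
have e2 : (inner_corner K phi).1 * sin phi <= p.1 * sin phi by rewrite ler_wpM2r// ltW.
have : p.2 * sin phi < (inner_corner K phi).2 * sin phi by lra.
rewrite ltr_pM2r// => h1.
have : p.2 * cos phi < (inner_corner K phi).2 * cos phi by rewrite ltr_pM2r.
lra.
Qed.

End right_leg_arc.

(** * Caps and the motion of the inner corner *)

(** The direction of the motion is strictly between [v_ t] and [- u_ t]; in
   particular the inner corner always moves to the left. *)
Definition corner_derivative (R : realType) (x x' : R -> R * R) :=
  forall t, 0 < t < pi / 2 ->
    [/\ is_derive t 1 (fst \o x) (x' t).1, is_derive t 1 (snd \o x) (x' t).2,
        dot (x' t) (u_ t) < 0 & 0 < dot (x' t) (v_ t)].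

(** The hypotheses on the cap that are invariant under reflection in a vertical
   line. *)
Record arch (R : realType) (K : set (R * R)) : Prop := Arch {
  arch_compact : compact K ;
  arch_nonempty : K !=set0 ;
  arch_convex : forall p q l, K p -> K q -> 0 <= l <= 1 -> K (l *: p + (1 - l) *: q) ;
  arch_strip : forall p, K p -> 0 <= p.2 <= 1 ;
  arch_top : support_fun K (pi / 2) = 1 ;
  arch_down : forall p y, K p -> 0 <= y <= p.2 -> K (p.1, y) ;
  arch_corner : exists x', corner_derivative (inner_corner K) x' }.

Section arch_theory.
Context {R : realType}.
Implicit Types (p q w : R * R) (K X : set (R * R)) (s t phi : R).

Lemma is_derive_limit (g : R -> R) (A : set R) t l : nbhs t A ->
  (s - t)^-1 * (g s - g t) @[s --> within A t^'] --> l -> is_derive t 1 g l.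
Proof.
move=> tA gl.
have H : (fun k => k^-1 *: (g (k *: 1 + t) - g t)) k @[k --> 0^'] --> l.
  apply/cvgrPdist_lt => e e0.
  have /cvgrPdist_lt/(_ e e0) := gl.
  rewrite !near_withinE => gP.
  have {gP} : \forall s \near t, s != t -> `|l - (s - t)^-1 * (g s - g t)| < e.
    by apply: filterS2 tA gP => s As gs st; exact: gs st As.
  move=> /nbhs_ballP[r /= r0 rP].
  apply/nbhs_ballP; exists r => //= k.
  rewrite /ball /= sub0r normrN => kr k0.
  have -> : k *: 1 = k by rewrite /GRing.scale /= mulr1.
  have := rP (k + t); rewrite /ball /= opprD addrCA subrr addr0 normrN => /(_ kr).
  by rewrite addrK; apply; rewrite -subr_eq0 addrK.
apply: DeriveDef; first by apply/cvg_ex; exists l.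
by apply: cvg_lim => //.
Qed.

Lemma is_derive_dot (x : R -> R * R) t (a w : R * R) :
  is_derive t 1 (fst \o x) a.1 -> is_derive t 1 (snd \o x) a.2 ->
  is_derive t 1 (fun s => dot (x s) w) (dot a w).
Proof.
move=> x1 x2; rewrite /dot.
have D1 := is_deriveM_pw x1 (is_derive_cst w.1 t 1).
have D2 := is_deriveM_pw x2 (is_derive_cst w.2 t 1).
apply: (is_derive_eq (is_deriveD_pw D1 D2)).
by rewrite /cst /=; ring.
Qed.

Section corner_motion.
Variables (x x' : R -> R * R).
Hypothesis xx' : corner_derivative x x'.

(** The direction of [x' s] lies between those of [v_ s] and [- u_ s], so it makes
   an obtuse angle with [u_ phi] as long as [phi <= s < phi + pi / 2]. *)
Lemma corner_decreasing phi s t : 0 < phi -> phi <= s -> s < t -> t < pi / 2 ->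
  dot (x t) (u_ phi) < dot (x s) (u_ phi).
Proof.
move=> f0 fs st t2.
have D r : 0 < r < pi / 2 ->
    is_derive r 1 (fun s => dot (x s) (u_ phi)) (dot (x' r) (u_ phi)).
  by move=> /xx'[? ? _ _]; exact: is_derive_dot.
have fC : {within `[s, t], continuous (fun s => dot (x s) (u_ phi))}.
  apply: continuous_in_subspaceT => r /set_mem; rewrite /= in_itv/= => /andP[r1 r2].
  apply/differentiable_continuous/derivable1_diffP.
  by case: (D r) => //; lra.
have D' r : r \in `]s, t[ ->
    is_derive r 1 (fun s => dot (x s) (u_ phi)) (dot (x' r) (u_ phi)).
  by rewrite in_itv/= => /andP[r1 r2]; apply: D; lra.
have [r] := MVT st D' fC; rewrite in_itv/= => /andP[r1 r2].
have rr : 0 < r < pi / 2 by lra.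
have [_ _ xu xv] := xx' rr => E.
rewrite -subr_lt0 E nmulr_rlt0 ?subr_gt0// (dot_u_rot_back _ phi r).
have c0 : 0 < cos (r - phi) by apply: cos_gt0_pihalf; lra.
have pi0 := @pi_gt0 R.
have s0 : 0 <= sin (r - phi) by apply: sin_ge0_pi; lra.
by rewrite subr_lt0 (lt_le_trans (y := 0))// ?nmulr_rlt0// mulr_ge0// ltW.
Qed.

End corner_motion.

(** The contact property comes from a minimum: the distance from a contact point [c]
   at [phi + pi / 2] to the support line at [s + pi / 2] vanishes at [s = phi], so
   its derivative does too, and this expresses [dot c (u_ phi)] through the
   derivative of the inner corner. *)
Lemma arch_right_leg phi K : 0 < phi < pi / 2 -> arch K -> right_leg phi K.
Proof.
move=> angle A; have [cK K0 cv st tp dn [x' xx']] := A.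
split=> //; last first.
  move=> t /andP[]; rewrite le_eqVlt => /predU1P[<- _|ft t2].
    by rewrite inner_corner_u.
  rewrite -inner_corner_u ltW//.
  by have /andP[f0 _] := angle; exact: (corner_decreasing xx').
have [c Kc [cE _]] := support_attained cK K0 (phi + pi / 2).
exists c => //; rewrite -cE u_Dpihalf; split=> //.
(* [D s + 1] is that distance, as [inner_corner K s] is at distance 1 from the
   support line *)
pose D s := dot (inner_corner K s) (v_ s) - dot c (v_ s).
have D' s : 0 < s < pi / 2 -> is_derive s 1 D
   (dot (x' s) (v_ s) - dot (inner_corner K s) (u_ s) + dot c (u_ s)).
  move=> /xx'[d1 d2 _ _]; rewrite /D.
  have E : (fun s => dot (inner_corner K s) (v_ s) - dot c (v_ s)) =
     (fun s => ((snd \o inner_corner K) s - c.2) * cos s +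
               - (((fst \o inner_corner K) s - c.1) * sin s)).
    by apply/funext => r; rewrite !dot_v /=; ring.
  rewrite E; derive_pw; rewrite dot_v !dot_u /=; ring.
have Dphi : is_derive phi 1 D 0.
  apply: (@derive1_at_min _ D 0 (pi / 2)).
  - by have /andP[] := angle; lra.
  - by move=> s; rewrite in_itv/= => /D'[].
  - by rewrite in_itv.
  move=> s _; rewrite /D !inner_corner_v -cE !u_Dpihalf.
  have := support_ub cK K0 (s + pi / 2) Kc; rewrite u_Dpihalf; lra.
have [_ DE] := Dphi; have [_] := D' _ angle; rewrite DE inner_corner_u.
by have [_ _ _ xv] := xx' _ angle; lra.
Qed.

(** A half-plane with normal angle in [[0, pi]] contains, with a point, all the
   points below it; this makes the cap closed downwards to the ground. *)
Lemma Ki_arch K : Ki K -> arch K.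
Proof.
move=> [[[K0 cK _] top bot [H [HI KE]]] _ [_ _ [x' [[_ xC1] xs]]]].
have pi0 := @pi_gt0 R.
have kub t p (Kp : K p) := support_ub cK K0 t Kp.
have u32 p : dot p (u_ (3 * pi / 2)) = - p.2.
  by rewrite pi32E u_Dpi dotNr u_pihalf /dot /= mulr0 mulr1 add0r.
have up2 p : dot p (u_ (pi / 2)) = p.2.
  by rewrite u_pihalf /dot /= mulr0 mulr1 add0r.
have strip p : K p -> 0 <= p.2 <= 1.
  move=> Kp; have := kub (pi / 2) _ Kp; have := kub (3 * pi / 2) _ Kp.
  by rewrite u32 up2 top bot; lra.
split=> //.
- move=> p q l; rewrite KE => Kp Kq /andP[l0 l1] k Hk /=.
  have := Kp _ Hk; have := Kq _ Hk => /= h1 h2.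
  rewrite dotDl !dotZl.
  have e1 : l * dot p (u_ k.1) <= l * k.2 by rewrite ler_wpM2l.
  have e2 : (1 - l) * dot q (u_ k.1) <= (1 - l) * k.2 by rewrite ler_wpM2l ?subr_ge0.
  lra.
- move=> p y Kp /andP[y0 yp]; rewrite KE => k Hk /=.
  have Kk q : K q -> dot q (u_ k.1) <= k.2 by rewrite KE => /(_ _ Hk).
  have [kI|k3] := HI _ Hk.
    apply: le_trans (Kk _ Kp); rewrite !dot_u /= lerD2l ler_wpM2r//.
    by apply: sin_ge0_pi; rewrite in_itv in kI.
  have [q Kq [qE _]] := support_attained cK K0 (3 * pi / 2).
  have := Kk _ Kq; rewrite k3 qE bot u32 /=; lra.
exists x' => t t02.
have tI : t \in `]0, pi / 2[ by rewrite in_itv.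
have tI' : t \in `[0, pi / 2] by rewrite in_itv/=; lra.
have [h1 h2] := xs _ tI.
have xl := xC1 _ tI'.
have tA : nbhs t [set` `[0, pi / 2]].
  by apply: filterS (near_in_itvoo tI) => s; exact: subset_itv_oo_cc.
split=> //; apply: (is_derive_limit tA).
  exact: (cvg_comp _ _ xl cvg_fst).
exact: (cvg_comp _ _ xl cvg_snd).
Qed.

End arch_theory.

(** * Reflection in a vertical line, and the two arcs *)

Section mirror.
Context {R : realType}.
Implicit Types (p q w : R * R) (K X : set (R * R)) (s t phi : R).

Definition mirror p : R * R := (- p.1, p.2).

Definition mirror_set X : set (R * R) := [set p | X (mirror p)].

Lemma mirrorK : involutive mirror.
Proof. by case=> x y; rewrite /mirror /= opprK. Qed.

Lemma dot_mirror p w : dot (mirror p) w = dot p (mirror w).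
Proof. by rewrite /dot /= mulNr mulrN. Qed.

Lemma mirror_u t : mirror (u_ t) = u_ (pi - t).
Proof. by rewrite /mirror /u_ cosB sinB cospi sinpi /=; congr pair; ring. Qed.

Lemma mirror_v t : mirror (v_ t) = - v_ (pi - t).
Proof.
by apply: injective_projections => /=; rewrite ?cosB ?sinB cospi sinpi; ring.
Qed.

Lemma mirror_uv t : mirror (v_ t) = u_ (pi / 2 - t).
Proof.
by rewrite /mirror /v_ /u_ cosB sinB cos_pihalf sin_pihalf /=; congr pair; ring.
Qed.

Lemma mirror_vu t : mirror (u_ t) = v_ (pi / 2 - t).
Proof.
by rewrite /mirror /v_ /u_ cosB sinB cos_pihalf sin_pihalf /=; congr pair; ring.
Qed.

Lemma support_fun_mirror X t : support_fun (mirror_set X) t = support_fun X (pi - t).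
Proof.
congr sup; apply/seteqP; split=> _ [p Xp <-].
  by exists (mirror p) => //; rewrite dot_mirror mirror_u opprB addrC subrK.
by exists (mirror p); rewrite /mirror_set /= ?mirrorK// dot_mirror mirror_u.
Qed.

Lemma inner_corner_mirror K t :
  inner_corner (mirror_set K) t = mirror (inner_corner K (pi / 2 - t)).
Proof.
rewrite /inner_corner !support_fun_mirror.
have -> : pi - (t + pi / 2) = pi / 2 - t :> R by lra.
have -> : pi / 2 - t + pi / 2 = pi - t :> R by lra.
rewrite -mirror_uv -mirror_vu.
by apply: injective_projections; rewrite /= /GRing.scale /=; ring.
Qed.

Lemma niche_mirror K p : niche (mirror_set K) p -> niche K (mirror p).
Proof.
move=> [p0 [t]]; rewrite /= in_itv/= => /andP[t0 t2] [pu pv]; split => //.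
exists (pi / 2 - t); first by rewrite /= in_itv/=; lra.
split; rewrite dot_mirror.
  rewrite mirror_u; have -> : pi - (pi / 2 - t) = t + pi / 2 by lra.
  rewrite u_Dpihalf; apply: lt_le_trans pv _; rewrite support_fun_mirror.
  by have -> : pi - (t + pi / 2) = pi / 2 - t by lra.
rewrite mirror_uv; have -> : pi / 2 - (pi / 2 - t) = t by lra.
apply: lt_le_trans pu _; rewrite support_fun_mirror.
by have -> : pi / 2 - t + pi / 2 = pi - t by lra.
Qed.

Lemma body_B_mirror phi K : body_B phi (mirror_set K) = mirror_set (body_D phi K).
Proof.
apply/seteqP; split=> p [Kp Bp]; split=> // t /=; rewrite in_itv/= => tI.
  have /= := Bp (pi / 2 - t); rewrite in_itv/= => /(_ _)/wrap[].
    by lra.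
  rewrite support_fun_mirror dot_mirror mirror_uv.
  by have -> : pi - (pi / 2 - t) = t + pi / 2 by lra.
have /= := Bp (pi / 2 - t); rewrite in_itv/= => /(_ _)/wrap[].
  by lra.
rewrite support_fun_mirror dot_mirror mirror_uv.
have -> : pi / 2 - (pi / 2 - t) = t by lra.
by have -> : pi / 2 - t + pi / 2 = pi - t by lra.
Qed.

Lemma u_D2pi t : u_ (t + pi *+ 2) = u_ t.
Proof. by rewrite /u_ cosD2pi sinD2pi. Qed.

Lemma v_D2pi t : v_ (t + pi *+ 2) = v_ t.
Proof. by rewrite /v_ cosD2pi sinD2pi. Qed.

Lemma edge_mirror X t p :
  edge (mirror_set X) (3 * pi - t) p <-> edge X t (mirror p).
Proof.
have -> : 3 * pi - t = (pi - t) + pi *+ 2 by lra.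
rewrite /edge /= /support_fun u_D2pi -/(support_fun (mirror_set X) (pi - t)).
rewrite support_fun_mirror dot_mirror mirror_u.
by have -> : pi - (pi - t) = t by lra.
Qed.

Lemma mirror_continuous : continuous mirror.
Proof.
move=> p; have c1 : - q.1 @[q --> p] --> - p.1 by apply: cvgN; exact: cvg_fst.
have c2 : q.2 @[q --> p] --> p.2 by exact: cvg_snd.
exact: (@cvg_pair _ _ _ (nbhs p) (nbhs (- p.1)) (nbhs p.2) _ _ _ _ _ c1 c2).
Qed.

Lemma arch_mirror K : arch K -> arch (mirror_set K).
Proof.
move=> [cK [p0 Kp0] cv st tp dn [x' xx']]; split.
- rewrite (_ : mirror_set K = mirror @` K).
    by apply: continuous_compact => //; apply: continuous_subspaceT; exact: mirror_continuous.
  apply/seteqP; split=> [p Kp|_ [p Kp <-]]; last by rewrite /mirror_set /= mirrorK.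
  by exists (mirror p) => //; exact: mirrorK.
- by exists (mirror p0); rewrite /mirror_set /= mirrorK.
- move=> p q l Kp Kq l01; have := cv _ _ _ Kp Kq l01.
  rewrite /mirror_set /=; congr K.
  by apply: injective_projections; rewrite /= /GRing.scale /=; ring.
- by move=> p /st.
- by rewrite support_fun_mirror -[RHS]tp; congr support_fun; lra.
- by move=> p y Kp /(dn _ _ Kp).
exists (fun t => - mirror (x' (pi / 2 - t))) => t t02.
have t02' : 0 < pi / 2 - t < pi / 2 by lra.
have [d1 d2 xu xv] := xx' _ t02'.
have dt : is_derive t 1 (fun t : R => pi / 2 - t) (-1).
  by derive_pw; rewrite add0r.
have c1 := is_derive_comp dt d1; have c2 := is_derive_comp dt d2.
split.
- rewrite (_ : fst \o _ = (fun s => - (fst \o inner_corner K) (pi / 2 - s))).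
    by apply: (is_derive_eq (is_deriveN_pw c1)) => /=; ring.
  by apply/funext => s; rewrite /comp inner_corner_mirror.
- rewrite (_ : snd \o _ = (fun s => (snd \o inner_corner K) (pi / 2 - s))).
    by apply: (is_derive_eq c2) => /=; ring.
  by apply/funext => s; rewrite /comp inner_corner_mirror.
- rewrite (_ : - _ = (-1) *: mirror (x' (pi / 2 - t))); last by rewrite scaleN1r.
  by rewrite dotZl dot_mirror mirror_vu mulN1r oppr_lt0.
rewrite (_ : - _ = (-1) *: mirror (x' (pi / 2 - t))); last by rewrite scaleN1r.
by rewrite dotZl dot_mirror mirror_uv mulN1r oppr_gt0.
Qed.

End mirror.

Section arcs.
Context {R : realType}.
Variables (phi : R) (K : set (R * R)).
Hypothesis KR : right_leg phi K.
Local Notation B := (body_B phi K).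

Lemma body_B_nonempty : B !=set0.
Proof. by have [p Bp _] := body_B_ground KR; exists p. Qed.

Lemma arc_area_body_B P : primitive_of (leg_slope phi) (leg_roof phi K) P ->
  arc_area B (pi + phi) (3 * pi / 2) =
  ((v_minus B (3 * pi / 2)).1 * (v_minus B (3 * pi / 2)).2
   - (v_plus B (pi + phi)).1 * (v_plus B (pi + phi)).2) / 2
  - (P (v_minus B (3 * pi / 2)).1 - P (v_plus B (pi + phi)).1).
Proof.
move=> GP; have cB := compact_body_B KR; have B0 := body_B_nonempty.
have [Xe Xl] := v_plusP cB B0 (pi + phi).
have [We Wl] := v_minusP cB B0 (3 * pi / 2).
have [X2 _] := arc_start_roof KR Xe.
have W2 : (v_minus B (3 * pi / 2)).2 = leg_roof phi K (v_minus B (3 * pi / 2)).1.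
  by rewrite (arc_end_roof KR We) (arc_end_on_ground KR We).
rewrite [in RHS]W2 [in RHS]X2; apply: arc_area_graph.
- exact: (arc_start_le_end KR Xe We).
- exact: (leg_slope_ge0 KR).
- exact: (leg_roof_lipschitz KR).
- exact: GP.
- by rewrite -X2 -surjective_pairing.
- by rewrite -W2 -surjective_pairing.
exact: (right_arcE KR Xe Xl We Wl).
Qed.

End arcs.

Section left_arcs.
Context {R : realType}.
Variables (phi : R) (K : set (R * R)).
Hypothesis KR : right_leg phi (mirror_set K).
Implicit Types (p q : R * R) (t : R).
Local Notation D := (body_D phi K).
Local Notation B := (body_B phi (mirror_set K)).
Local Notation phiL := (3 * pi / 2 + (pi / 2 - phi)).

Lemma body_D_mirror : D = mirror_set B.
Proof. by rewrite body_B_mirror; apply/seteqP; split=> p; rewrite /mirror_set /= mirrorK. Qed.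

Lemma compact_body_D : compact D.
Proof.
rewrite body_D_mirror (_ : mirror_set B = mirror @` B).
  apply: continuous_compact; last exact: (compact_body_B KR).
  by apply: continuous_subspaceT; exact: mirror_continuous.
apply/seteqP; split=> [p Kp|_ [p Kp <-]]; last by rewrite /mirror_set /= mirrorK.
by exists (mirror p) => //; exact: mirrorK.
Qed.

Lemma body_D_nonempty : D !=set0.
Proof.
have [p Bp] := body_B_nonempty KR; exists (mirror p).
by rewrite body_D_mirror /mirror_set /= mirrorK.
Qed.

Lemma edge_body_D t p : edge B (3 * pi - t) (mirror p) <-> edge D t p.
Proof. by rewrite body_B_mirror edge_mirror mirrorK. Qed.

Lemma v_mirror3 p t : dot (mirror p) (v_ (3 * pi - t)) = - dot p (v_ t).
Proof.
have -> : 3 * pi - t = (pi - t) + pi *+ 2 by lra.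
rewrite v_D2pi dot_mirror -dotNr; congr dot.
by rewrite mirror_v (_ : pi - (pi - t) = t)//; lra.
Qed.

(* Reflection sends the angle [t] to [pi - t]; adding a full turn keeps the angles
   of the two arcs in the same range. *)
Let angle_start : 3 * pi - phiL = pi + phi :> R. Proof. by lra. Qed.
Let angle_end : 3 * pi - 3 * pi / 2 = 3 * pi / 2 :> R. Proof. by lra. Qed.

Lemma left_start : edge B (pi + phi) (mirror (v_minus D phiL)) /\
  forall q, edge B (pi + phi) q ->
    dot q (v_ (pi + phi)) <= dot (mirror (v_minus D phiL)) (v_ (pi + phi)).
Proof.
have [Ye Yl] := v_minusP compact_body_D body_D_nonempty phiL.
rewrite -angle_start; split; first exact/edge_body_D.
move=> q; rewrite -(mirrorK q) => /edge_body_D /Yl.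
by rewrite !v_mirror3 lerN2.
Qed.

Lemma left_end : edge B (3 * pi / 2) (mirror (v_plus D (3 * pi / 2))) /\
  forall q, edge B (3 * pi / 2) q ->
    dot (mirror (v_plus D (3 * pi / 2))) (v_ (3 * pi / 2)) <= dot q (v_ (3 * pi / 2)).
Proof.
suff H t : edge B (3 * pi - t) (mirror (v_plus D t)) /\ forall q,
    edge B (3 * pi - t) q -> dot (mirror (v_plus D t)) (v_ (3 * pi - t)) <=
                             dot q (v_ (3 * pi - t)).
  by have := H (3 * pi / 2); rewrite angle_end.
have [Ye Yl] := v_plusP compact_body_D body_D_nonempty t.
split; first exact/edge_body_D.
move=> q; rewrite -(mirrorK q) => /edge_body_D /Yl.
by rewrite !v_mirror3 lerN2.
Qed.

Lemma arc_area_body_D P :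
  primitive_of (leg_slope phi) (fun x => leg_roof phi (mirror_set K) (- x)) P ->
  arc_area D (3 * pi / 2) phiL =
  ((v_minus D phiL).1 * (v_minus D phiL).2
   - (v_plus D (3 * pi / 2)).1 * (v_plus D (3 * pi / 2)).2) / 2
  - (P (v_minus D phiL).1 - P (v_plus D (3 * pi / 2)).1).
Proof.
move=> GP; have [Xe Xl] := left_start; have [We Wl] := left_end.
set Y := v_minus D phiL in Xe Xl *; set Z := v_plus D (3 * pi / 2) in We Wl *.
have [X2 _] := arc_start_roof KR Xe.
have W2 : Z.2 = leg_roof phi (mirror_set K) (- Z.1).
  by have := arc_end_roof KR We; have := arc_end_on_ground KR We => /= -> ->.
have XW := arc_start_le_end KR Xe We.
rewrite [in RHS]W2 [in RHS](X2 : Y.2 = _).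
apply: (arc_area_graph (k := leg_slope phi)
  (G := fun x => leg_roof phi (mirror_set K) (- x))).
- by move: XW; rewrite /= lerN2.
- exact: (leg_slope_ge0 KR).
- move=> s t; apply: le_trans (leg_roof_lipschitz KR _ _) _.
  by rewrite -opprD normrN.
- exact: GP.
- by rewrite -W2 -surjective_pairing.
- by rewrite -(X2 : Y.2 = _) -surjective_pairing.
have := right_arcE KR Xe Xl We Wl => arcE.
have memE p : normal_arc D (3 * pi / 2) phiL p <->
   ([set mirror Y] `|` \bigcup_(t in `]pi + phi, 3 * pi / 2[) edge B t
      `|` [set mirror Z]) (mirror p).
  rewrite /normal_arc -/Y -/Z; split=> [[[->|[t tI tp]]|->]|[[pY|[t tI tp]]|pZ]].
  - by right.
  - left; right; exists (3 * pi - t); last exact/edge_body_D.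
    by move: tI; rewrite /= !in_itv/=; lra.
  - by left; left.
  - by right; rewrite -(mirrorK p) pY mirrorK.
  - left; right; exists (3 * pi - t); first by move: tI; rewrite /= !in_itv/=; lra.
    by apply/edge_body_D; have -> : 3 * pi - (3 * pi - t) = t by lra.
  - by left; left; rewrite -(mirrorK p) pZ mirrorK.
apply/seteqP; split=> [p /memE|p pE].
  by rewrite arcE /= !in_itv/= lerN2 lerN2 => -[/andP[-> ->]].
apply/memE; rewrite arcE /=; move: pE; rewrite /= !in_itv/= !lerN2.
by move=> [/andP[-> ->]].
Qed.

End left_arcs.

(** * Comparison of the niche with the closed curve *)

Section primitive_calculus.
Context {R : realType}.
Implicit Types (a b k : R) (G P : R -> R).

Lemma primitive_ofD k k' G G' P P' : primitive_of k G P -> primitive_of k' G' P' ->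
  primitive_of (k + k') (fun x => G x + G' x) (fun x => P x + P' x).
Proof.
move=> GP G'P' s t.
rewrite (_ : _ - _ = (P t - P s - G s * (t - s)) + (P' t - P' s - G' s * (t - s))).
  by rewrite mulrDl; exact: le_trans (ler_normD _ _) (lerD (GP _ _) (G'P' _ _)).
by ring.
Qed.

Lemma primitive_ofN k G P : primitive_of k G P ->
  primitive_of k (fun x => - G x) (fun x => - P x).
Proof.
move=> GP s t; apply: le_trans (GP s t); rewrite -normrN le_eqVlt.
by apply/orP; left; apply/eqP; congr `|_|; ring.
Qed.

Lemma affine_lipschitz (al be : R) :
  lipschitz_with `|be| (fun x => al + be * x).
Proof.
by move=> s t; rewrite (_ : _ - _ = be * (s - t)) ?normrM//; ring.
Qed.

Lemma affine_primitive (al be : R) :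
  primitive_of `|be| (fun x => al + be * x) (fun x => al * x + be * x ^+ 2 / 2).
Proof.
move=> s t; rewrite (_ : _ - _ = be / 2 * (t - s) ^+ 2); last by field.
rewrite normrM (ger0_norm (sqr_ge0 (t - s))) ler_wpM2r ?sqr_ge0//.
by rewrite normrM ler_piMr// ger0_norm; lra.
Qed.

(** Both sides are the Stieltjes integral of the common integrand against the
   identity. *)
Lemma primitive_eq k k' G G' P P' a b : a <= b -> 0 <= k -> 0 <= k' ->
  lipschitz_with k G -> lipschitz_with k' G' ->
  primitive_of k G P -> primitive_of k' G' P' ->
  (forall x, a <= x <= b -> G x = G' x) -> P b - P a = P' b - P' a.
Proof.
move=> ab k0 k'0 Gk Gk' GP GP' GG'.
have idC : {within `[a, b], continuous (@idfun R)}.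
  by apply: continuous_subspaceT => x; exact: cvg_id.
have idBV : bounded_variation a b (@idfun R) by exact: nondecreasing_bounded_variation.
have h1 := is_RSint_graph_ydx ab k0 idC idBV Gk GP (y := G') _.
have h2 := is_RSint_graph_ydx ab k'0 idC idBV Gk' GP' (y := G') (fun _ _ => erefl).
apply: (is_RSint_unique ab (h1 _) h2) => t; rewrite in_itv/= => tab.
by rewrite GG'.
Qed.

(** The analogue of [curve_area_graph], with the explicit primitive of an affine
   function. *)
Lemma segment_area_affine (al be : R) (p q : R * R)
    (P := fun x => al * x + be * x ^+ 2 / 2) :
  p.2 = al + be * p.1 -> q.2 = al + be * q.1 ->
  segment_area p q = (q.1 * q.2 - p.1 * p.2) / 2 - (P q.1 - P p.1).
Proof. by rewrite /segment_area /P => -> ->; field. Qed.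

End primitive_calculus.

(** The two intervals are disjoint since [F <= r]; if [r < 0], then [F] is negative
   and compensates the part of [g - r] below 0. *)
Lemma lebesgue_measure_ge_gap (R : realType) (S : set R) (F r g : R) :
  F <= r -> r <= g -> 0 <= g -> `[0, F[ `<=` S -> `[Num.max r 0, g[ `<=` S ->
  ((g - r + F)%:E <= lebesgue_measure S)%E.
Proof.
move=> Fr rg g0 FS gS.
pose a := Num.max F 0; pose m := Num.max r 0.
have a0 : 0 <= a by rewrite /a le_max lexx orbT.
have am : a <= m by rewrite /a /m ge_max !le_max Fr lexx !orbT.
have mg : m <= g by rewrite /m ge_max rg g0.
apply: (@le_trans _ _ (lebesgue_measure (`[0, a[%classic `|` `[m, g[%classic : set R))).
  rewrite measureU//=; last first.
    apply/seteqP; split=> // y [/=]; rewrite !in_itv/= => /andP[_ ya] /andP[my _].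
    by have := lt_le_trans ya (le_trans am my); rewrite ltxx.
  rewrite !lebesgue_measure_itv/= !lte_fin.
  have E (u v : R) : u <= v ->
      (if (u < v)%R then v%:E - u%:E else 0)%E = (v - u)%:E :> \bar R.
    by move=> uv; case: ltP => // vu; rewrite (_ : v = u) ?subrr//; apply/le_anti/andP.
  rewrite !E// -EFinD lee_fin subr0 /a /m.
  by case: (leP F 0); case: (leP r 0) => r0 F0; lra.
apply: le_lebesgue_measure => y [|]; last exact: gS.
rewrite /a; case: (leP F 0) => _; last exact: FS.
by rewrite /= in_itv/= => /andP[y0 /(le_lt_trans y0)]; rewrite ltxx.
Qed.

Section sofa_upper_bound.
Context {R : realType}.
Variables (phi : R) (K : set (R * R)).
Hypotheses (quarter : 0 < phi < pi / 4) (A : arch K)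
  (wide : 2 + 2 * sin phi <= support_fun K phi + support_fun K (pi - phi)).
Implicit Types (p q : R * R) (s t x y : R).

Local Notation phiL := (pi / 2 - phi).
Local Notation corner := (inner_corner K).
Local Notation mK := (mirror_set K).
Local Notation k := (leg_slope phi).
Local Notation cR := (corner phi).
Local Notation cL := (corner phiL).

Let angle : 0 < phi < pi / 2.
Proof. by have pi0 := @pi_gt0 R; have /andP[f0 f4] := quarter; lra. Qed.

Let phi_le_phiL : phi <= phiL.
Proof. by have /andP[f0 f4] := quarter; lra. Qed.

Let KR : right_leg phi K := arch_right_leg angle A.
Let KL : right_leg phi mK := arch_right_leg angle (arch_mirror A).

Let sphi0 : 0 < sin phi.
Proof.
have pi0 := @pi_gt0 R; have /andP[f0 f2] := angle.
by apply: sin_gt0_pi; apply/andP; split; lra.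
Qed.
Let cphi0 : 0 < cos phi.
Proof.
have pi0 := @pi_gt0 R; have /andP[f0 f2] := angle.
by apply: cos_gt0_pihalf; apply/andP; split; lra.
Qed.
Let k0 : 0 <= k := leg_slope_ge0 KR.

Let gR := leg_roof phi K.
Let gL x := leg_roof phi mK (- x).
Let aR := (support_fun K phi - 1) / sin phi.
Let aL := (support_fun K (pi - phi) - 1) / sin phi.
Let lR x := aR + (- k) * x.
Let lL x := aL + k * x.

Let lRE x : leg_line K phi x = lR x.
Proof. by rewrite /leg_line /lR /aR /leg_slope; ring. Qed.

Let lLE x : leg_line mK phi (- x) = lL x.
Proof. by rewrite /leg_line /lL /aL /leg_slope support_fun_mirror; ring. Qed.

Let lines_sum x : 2 <= lR x + lL x.
Proof.
rewrite (_ : _ + _ = (support_fun K phi + support_fun K (pi - phi) - 2) / sin phi).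
  by rewrite ler_pdivlMr//; have := wide; lra.
by rewrite /lR /lL /aR /aL; ring.
Qed.

Let on_lR p : dot p (u_ phi) = support_fun K phi - 1 -> p.2 = lR p.1.
Proof.
move=> pE; rewrite /lR /aR -pE dot_u /leg_slope; field.
by rewrite gt_eqF.
Qed.

Let on_lL p : dot p (mirror (u_ phi)) = support_fun K (pi - phi) - 1 -> p.2 = lL p.1.
Proof.
move=> pE; rewrite /lL /aL -pE /dot /mirror /= /leg_slope; field.
by rewrite gt_eqF.
Qed.

Let cR_on : cR.2 = lR cR.1.
Proof. by apply: on_lR; rewrite inner_corner_u. Qed.

Let cL_on : cL.2 = lL cL.1.
Proof.
apply: on_lL; rewrite mirror_vu inner_corner_v.
by have -> : pi / 2 - phi + pi / 2 = pi - phi by lra.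
Qed.

(* Both [dot _ (u_ phi)] and its mirror image are monotone along the inner
   corner curve; the lines at [phi] and its mirror image have slopes -k and k. *)
Let corner_slope s t : phi <= s -> s < t -> t <= phiL ->
  (corner t).1 < (corner s).1 /\
  `|(corner t).2 - (corner s).2| <= k * ((corner s).1 - (corner t).1).
Proof.
move=> fs st tL; have /andP[f0 f2] := angle.
have [x' xx'] := arch_corner A; have [y' yy'] := arch_corner (arch_mirror A).
have h1 : dot (corner t) (u_ phi) < dot (corner s) (u_ phi).
  by apply: (corner_decreasing xx'); lra.
have h2 : dot (inner_corner mK (pi / 2 - s)) (u_ phi)
        < dot (inner_corner mK (pi / 2 - t)) (u_ phi).
  by apply: (corner_decreasing yy'); lra.
rewrite !inner_corner_mirror in h2.
have E r : pi / 2 - (pi / 2 - r) = r by lra.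
rewrite !E in h2; move: h1 h2.
move: (corner t) (corner s) => [t1 t2] [s1 s2]; rewrite !dot_u /= => h1 h2.
have d1 : t1 < s1 by rewrite -(ltr_pM2r cphi0); lra.
split=> //.
rewrite -(ler_pM2r sphi0) (_ : k * _ * _ = cos phi * (s1 - t1)).
  rewrite -[X in _ * X](gtr0_norm sphi0) -normrM ler_norml.
  by apply/andP; split; lra.
by rewrite /leg_slope; field; rewrite gt_eqF.
Qed.

Let corner_lip s t : s \in `[phi, phiL] -> t \in `[phi, phiL] ->
  `|(corner t).2 - (corner s).2| <= k * `|(corner t).1 - (corner s).1|.
Proof.
rewrite !in_itv/= => /andP[s1 s2] /andP[t1 t2].
have [st|ts|->] := ltgtP s t; last by rewrite !subrr !normr0 mulr0.
  have [d1 d2] := corner_slope s1 st t2; apply: le_trans d2 _.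
  by rewrite ler_wpM2l// -normrN opprB ler_norm.
have [d1 d2] := corner_slope t1 ts s2; rewrite distrC; apply: le_trans d2 _.
by rewrite ler_wpM2l// ler_norm.
Qed.


Let corner_below_lR t : phi <= t < pi / 2 -> (corner t).2 <= lR (corner t).1.
Proof.
move=> tI; have /andP[_ /ltW f2] := angle; rewrite -lRE (leg_line_ge KR).
  exact: (leg_corner KR).
by rewrite in_itv/= lexx.
Qed.

Let corner_below_lL t : 0 < t <= phiL -> (corner t).2 <= lL (corner t).1.
Proof.
move=> tI; have /andP[_ /ltW f2] := angle.
have := leg_corner KL (t := pi / 2 - t); rewrite inner_corner_mirror.
have -> : pi / 2 - (pi / 2 - t) = t by lra.
have -> : phi <= pi / 2 - t < pi / 2 by lra.
move=> /(_ isT); rewrite -(leg_line_ge KL) ?in_itv/= ?lexx//.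
by rewrite lLE.
Qed.

(* [F] is the least [k]-Lipschitz function whose graph contains the inner corner
   curve over [[phi, phiL]]; it continues the curve by the lines of slope [- k] and
   [k] through its endpoints. *)
Let bump t x := (corner t).2 - k * `|x - (corner t).1|.
Let F := sup_fun `[phi, phiL]%classic bump.

Let bump_lip t : lipschitz_with k (bump t).
Proof.
move=> x y; rewrite /bump (_ : _ - _ = k * (`|y - (corner t).1| - `|x - (corner t).1|)).
  rewrite normrM (ger0_norm k0) ler_wpM2l//.
  apply: le_trans (ler_dist_dist _ _) _.
  by rewrite opprB addrA subrK distrC.
by ring.
Qed.

Let bump_le_lR t x : t \in `[phi, phiL] -> bump t x <= lR x.
Proof.
rewrite in_itv/= => /andP[t1 t2]; have /andP[f0 f4] := quarter.
have tI : phi <= t < pi / 2 by lra.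
have := corner_below_lR tI; rewrite /bump /lR => h1.
have := ler_wpM2l k0 (ler_norm (x - (corner t).1)); lra.
Qed.

Let bump_le_lL t x : t \in `[phi, phiL] -> bump t x <= lL x.
Proof.
rewrite in_itv/= => /andP[t1 t2]; have /andP[f0 f4] := quarter.
have tI : 0 < t <= phiL by lra.
have := corner_below_lL tI; rewrite /bump /lL => h1.
have := ler_wpM2l k0 (ler_norm ((corner t).1 - x)); rewrite distrC; lra.
Qed.

Let itv0 : `[phi, phiL]%classic !=set0.
Proof. by exists phi; rewrite /= in_itv/= lexx phi_le_phiL. Qed.

Let bump_ub x : has_ubound [set bump t x | t in `[phi, phiL]%classic].
Proof. by exists (lR x) => _ [t tI <-]; exact: bump_le_lR. Qed.

Let F_lip : lipschitz_with k F.
Proof. by apply: sup_fun_lipschitz => // t _; exact: bump_lip. Qed.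

Let F_le_lR x : F x <= lR x.
Proof. by apply: sup_fun_le => // t; exact: bump_le_lR. Qed.

Let F_le_lL x : F x <= lL x.
Proof. by apply: sup_fun_le => // t; exact: bump_le_lL. Qed.

Let F_corner t : t \in `[phi, phiL] -> F (corner t).1 = (corner t).2.
Proof.
move=> tI; apply/le_anti/andP; split.
  apply: sup_fun_le => // s sI; rewrite /bump lerBlDl.
  have := corner_lip tI sI; rewrite [X in _ <= k * X]distrC.
  by move=> /(le_trans (ler_norm _)); lra.
have := sup_fun_ub bump_ub (corner t).1 tI.
by rewrite /bump subrr normr0 mulr0 subr0.
Qed.

Let phiI : phi \in `[phi, phiL].
Proof. by rewrite in_itv/= lexx phi_le_phiL. Qed.

Let phiLI : phiL \in `[phi, phiL].
Proof. by rewrite in_itv/= lexx phi_le_phiL. Qed.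

Let F_right x : cR.1 <= x -> F x = lR x.
Proof.
move=> cx; apply/le_anti; rewrite F_le_lR /=.
have := sup_fun_ub bump_ub x phiI; rewrite /bump ger0_norm ?subr_ge0//.
apply: le_trans; rewrite cR_on /lR; lra.
Qed.

Let F_left x : x <= cL.1 -> F x = lL x.
Proof.
move=> cx; apply/le_anti; rewrite F_le_lL /=.
have := sup_fun_ub bump_ub x phiLI; rewrite /bump ler0_norm ?subr_le0//.
apply: le_trans; rewrite cL_on /lL; lra.
Qed.

Let corner_fst_continuous : {within `[phi, phiL], continuous (fst \o corner)}.
Proof.
have [x' xx'] := arch_corner A; have /andP[f0 f4] := quarter.
apply: continuous_in_subspaceT => t /set_mem; rewrite /= in_itv/= => /andP[t1 t2].
apply/differentiable_continuous/derivable1_diffP.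
have tI : 0 < t < pi / 2 by lra.
by have [[]] := xx' t tI.
Qed.

Let corner_fst_BV : bounded_variation phi phiL (fst \o corner).
Proof.
have : bounded_variation phi phiL (\- (fst \o corner)).
  apply: nondecreasing_bounded_variation => s t; rewrite !in_itv/= => /andP[s1 _] /andP[_ t2].
  rewrite le_eqVlt => /predU1P[->//|st]; rewrite lerN2 ltW//.
  by have [] := corner_slope s1 st t2.
move/bounded_variationN; congr bounded_variation.
by apply/funext => t /=; rewrite opprK.
Qed.

Let niche_below_corner t p : 0 < t < pi / 2 -> 0 <= p.2 -> p.1 = (corner t).1 ->
  p.2 < (corner t).2 -> niche K p.
Proof.
move=> tI p0 p1 p2; have pi0 := @pi_gt0 R.
have st : 0 < sin t by apply: sin_gt0_pi; lra.
have ct : 0 < cos t by apply: cos_gt0_pihalf; lra.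
split=> //; exists t; first by rewrite /= in_itv.
split; first by rewrite -inner_corner_u !dot_u p1 ltrD2l ltr_pM2r.
by rewrite -inner_corner_v !dot_v p1 ltrD2r ltr_pM2r.
Qed.

Let niche_F x : `[0, F x[ `<=` xsection (niche K) x.
Proof.
move=> y; rewrite /= in_itv/= => /andP[y0 yF]; rewrite /xsection /= inE.
have [cx|xc] := leP cR.1 x.
  apply: (niche_right_of_corner KR) => //=.
  by rewrite lRE -F_right.
have [xc'|cx] := leP x cL.1.
  rewrite -[(x, y)]mirrorK; apply: niche_mirror.
  apply: (niche_right_of_corner KL) => //; last by rewrite /= lLE -F_left.
  by rewrite inner_corner_mirror; change (- cL.1 <= - x); rewrite lerN2.
have [|t tI tx] := @IVT R _ phi phiL x phi_le_phiL corner_fst_continuous.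
  by rewrite /= ge_min le_max (ltW cx) (ltW xc) !orbT.
move: (tI); rewrite in_itv/= => /andP[t1 t2]; have /andP[f0 f4] := quarter.
apply: (@niche_below_corner t) => //; first lra.
by rewrite -F_corner// -[(corner t).1]/((fst \o corner) t) tx.
Qed.

Local Notation B := (body_B phi K).
Local Notation D := (body_D phi K).
Local Notation X := (v_plus B (pi + phi)).
Local Notation W := (v_minus B (3 * pi / 2)).
Local Notation Y := (v_minus D (3 * pi / 2 + phiL)).
Local Notation Z := (v_plus D (3 * pi / 2)).

Let XP := v_plusP (compact_body_B KR) (body_B_nonempty KR) (pi + phi).
Let WP := v_minusP (compact_body_B KR) (body_B_nonempty KR) (3 * pi / 2).
Let YP := left_start KL.
Let ZP := left_end KL.

Let gR_ge0 x : 0 <= gR x. Proof. exact: (leg_roof_ge0 KR). Qed.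
Let gL_ge0 x : 0 <= gL x. Proof. exact: (leg_roof_ge0 KL). Qed.

Let phi_top : phi \in `[phi, pi / 2].
Proof. by have /andP[_ /ltW f2] := angle; rewrite in_itv/= lexx. Qed.

Let lR_le x : lR x <= gR x.
Proof. by rewrite -lRE; exact: (leg_line_le_roof KR). Qed.

Let lL_le x : lL x <= gL x.
Proof. by rewrite -lLE; exact: (leg_line_le_roof KL). Qed.

Let gR_le1 x : lR x < gR x -> gR x <= 1.
Proof. by rewrite -lRE; exact: (roof_le1 KR XP.1). Qed.

Let gL_le1 x : lL x < gL x -> gL x <= 1.
Proof. by rewrite -lLE; exact: (roof_le1 KL YP.1). Qed.

Let niche_gR x : `[Num.max (lR x) 0, gR x[ `<=` xsection (niche K) x.
Proof.
move=> y; rewrite /= in_itv/= ge_max => /andP[/andP[ly y0] yg].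
rewrite /xsection /= inE; apply: (niche_under_roof KR) => //=.
by rewrite lRE.
Qed.

Let niche_gL x : `[Num.max (lL x) 0, gL x[ `<=` xsection (niche K) x.
Proof.
move=> y; rewrite /= in_itv/= ge_max => /andP[/andP[ly y0] yg].
rewrite /xsection /= inE -[(x, y)]mirrorK; apply: niche_mirror.
by apply: (niche_under_roof KL) => //=; rewrite lLE.
Qed.

(* The integral of [height] is the signed area enclosed by the closed curve of the
   functional. The pieces above the two lines do not both occur over the same point,
   as the lines meet at height at least 1. *)
Let height x := (gR x - lR x + F x) + (gL x - lL x).

Let height_le x :
  ((height x)%:E <= lebesgue_measure (xsection (niche K) x))%E.
Proof.
rewrite /height; have ls := lines_sum x.
have [gr|gr] := ltP (lR x) (gR x).
  have gl : gL x = lL x.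
    apply/le_anti; rewrite lL_le andbT leNgt; apply/negP => gl.
    have := gR_le1 gr; have := gL_le1 gl; lra.
  by rewrite gl subrr addr0; exact: lebesgue_measure_ge_gap.
have -> : gR x = lR x by apply/le_anti; rewrite gr lR_le.
by rewrite subrr add0r addrC; exact: lebesgue_measure_ge_gap.
Qed.

Let niche_bounded : exists a b d, [/\ a <= b, 0 <= d &
  niche K `<=` `[a, b] `*` `[0, d]].
Proof.
have [cK K0 _ st _ _ _] := A.
have [pr _ prP] := compact_dot_max (1, 0) cK K0.
have [pl _ plP] := compact_dot_max (-1, 0) cK K0.
pose M := `|pr.1| + `|pl.1|.
have KM p : K p -> - M <= p.1 <= M.
  move=> Kp; have := prP _ Kp; have := plP _ Kp; rewrite /dot /= => h1 h2.
  have := ler_norm pr.1; have := ler_norm (- pl.1); rewrite normrN => h3 h4.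
  by have := normr_ge0 pr.1; have := normr_ge0 pl.1; rewrite /M; lra.
have M0 : 0 <= M by rewrite addr_ge0.
exists (- M), M, (2 * M + 1); split; [lra|lra|].
move=> p [/= p0 [t]]; rewrite /= in_itv/= => tI [].
have pi0 := @pi_gt0 R.
have sn : 0 < sin t by apply: sin_gt0_pi; lra.
have cs : 0 < cos t by apply: cos_gt0_pihalf; lra.
have s1 := @sin_le1 R t; have c1 := @cos_le1 R t.
have hu : support_fun K t <= M * cos t + sin t.
  apply: (support_le cK K0) => q Kq; have /andP[q0 q1] := st _ Kq.
  have /andP[_ qM] := KM _ Kq; rewrite dot_u lerD//; first by rewrite ler_pM2r.
  by rewrite ler_piMl// ltW.
have hv : support_fun K (t + pi / 2) <= M * sin t + cos t.
  apply: (support_le cK K0) => q Kq; have /andP[q0 q1] := st _ Kq.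
  have /andP[qM _] := KM _ Kq; rewrite u_Dpihalf dot_v addrC lerD//.
    by rewrite -mulNr ler_pM2r//; lra.
  by rewrite ler_piMl// ltW.
rewrite dot_u dot_v => pu pv.
have e1 : 0 <= p.2 * sin t by rewrite mulr_ge0// ltW.
have e2 : 0 <= p.2 * cos t by rewrite mulr_ge0// ltW.
have x1 : p.1 <= M.
  rewrite -(ler_pM2r cs); move: pu hu e1 s1; set hh := support_fun K t.
  move: (p.1 * cos t) (p.2 * sin t) (M * cos t) (sin t) => *; lra.
have x2 : - M <= p.1.
  rewrite -(ler_pM2r sn) mulNr; move: pv hv e2 c1; set hh := support_fun K _.
  move: (p.1 * sin t) (p.2 * cos t) (M * sin t) (cos t) => *; lra.
split; rewrite /= in_itv/= ?x1 ?x2 ?p0//=.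
have e3 : (p.1 * cos t + p.2 * sin t) * sin t <= (M * cos t + sin t - 1) * sin t.
  by rewrite ler_pM2r//; lra.
have e4 : (p.2 * cos t - p.1 * sin t) * cos t <= (M * sin t + cos t - 1) * cos t.
  by rewrite ler_pM2r//; lra.
have e5 : p.2 * (cos t ^+ 2 + sin t ^+ 2) <= 2 * M * (sin t * cos t)
    + (cos t ^+ 2 + sin t ^+ 2) - sin t - cos t by lra.
rewrite cos2Dsin2 mulr1 in e5.
have e6 : 2 * M * (sin t * cos t) <= 2 * M * 1.
  by rewrite ler_wpM2l ?mulr_ge0// -[1]mulr1 ler_pM// ltW.
lra.
Qed.

Let gL_lip : lipschitz_with k gL.
Proof.
move=> s t; apply: le_trans (leg_roof_lipschitz KL _ _) _.
by rewrite -opprD normrN.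
Qed.

(** Every piece of the closed curve contributes a boundary term, which telescopes
   around the curve, and the increment of a primitive. The increments add up to the
   integral of [height], because the roofs coincide with the lines or with the
   ground outside the arcs. *)
Lemma arch_sofa_area_le : sofa_area K <= Qfun phi K B D.
Proof.
have gR_lip : lipschitz_with k gR := leg_roof_lipschitz KR.
have lR_lip : lipschitz_with `|- k| lR := affine_lipschitz aR (- k).
have lL_lip : lipschitz_with `|k| lL := affine_lipschitz aL k.
have [PgR PgRP _] := lipschitz_primitive gR_lip.
have [PgL PgLP _] := lipschitz_primitive gL_lip.
have [PF PFP _] := lipschitz_primitive F_lip.
have PlRP := affine_primitive aR (- k).
have PlLP := affine_primitive aL k.
pose PlR x := aR * x + (- k) * x ^+ 2 / 2.
pose PlL x := aL * x + k * x ^+ 2 / 2.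
have h_lip := lipschitz_withD
  (lipschitz_withD (lipschitz_withD gR_lip (lipschitz_withN lR_lip)) F_lip)
  (lipschitz_withD gL_lip (lipschitz_withN lL_lip)).
have hP := primitive_ofD
  (primitive_ofD (primitive_ofD PgRP (primitive_ofN PlRP)) PFP)
  (primitive_ofD PgLP (primitive_ofN PlLP)).
have [Ph PhP Phint] := lipschitz_primitive h_lip.
(* an interval containing the whole configuration *)
pose b := `|X.1| + `|W.1| + `|Y.1| + `|Z.1| + `|cR.1| + `|cL.1|.
have nX := normr_ge0 X.1; have nW := normr_ge0 W.1; have nY := normr_ge0 Y.1.
have nZ := normr_ge0 Z.1; have nR := normr_ge0 cR.1; have nL := normr_ge0 cL.1.
have inb x : `|x| <= b -> - b <= x <= b by rewrite ler_norml.
have bX : - b <= X.1 <= b by apply: inb; rewrite /b; lra.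
have bW : - b <= W.1 <= b by apply: inb; rewrite /b; lra.
have bY : - b <= Y.1 <= b by apply: inb; rewrite /b; lra.
have bZ : - b <= Z.1 <= b by apply: inb; rewrite /b; lra.
have bR : - b <= cR.1 <= b by apply: inb; rewrite /b; lra.
have bL : - b <= cL.1 <= b by apply: inb; rewrite /b; lra.
have bb : - b <= b by lra.
have N : Ph b - Ph (- b) <= area (niche K).
  have [u [v [d [uv d0 NB]]]] := niche_bounded.
  rewrite Phint//; apply: (area_ge_integral uv d0 NB h_lip) => x _.
  exact: height_le.
have kk : 0 <= k + `|- k| + k + (k + `|k|) by rewrite !addr_ge0.
rewrite (primitive_eq bb kk kk h_lip h_lip PhP hP (fun _ _ => erefl)) in N.
have zlip : lipschitz_with 0 (fun=> 0 : R) by move=> s t; rewrite subrr normr0 mul0r.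
have zP : primitive_of 0 (fun=> 0 : R) (fun=> 0 : R).
  by move=> s t; rewrite subrr !mul0r subrr normr0.
have nk := normr_ge0 k; have nk' := normr_ge0 (- k).
have /andP[bX1 bX2] := bX; have /andP[bW1 bW2] := bW.
have /andP[bY1 bY2] := bY; have /andP[bZ1 bZ2] := bZ.
have /andP[bR1 bR2] := bR; have /andP[bL1 bL2] := bL.
have i1 : PgR b - PgR W.1 = 0 - 0.
  apply: (primitive_eq bW2 k0 (lexx 0) gR_lip zlip PgRP zP) => x /andP[Wx _].
  exact: (roof_right_of_arc KR WP.1).
have i2 : PgR X.1 - PgR (- b) = PlR X.1 - PlR (- b).
  apply: (primitive_eq bX1 k0 nk' gR_lip lR_lip PgRP PlRP) => x /andP[_ xX].
  by rewrite -lRE; exact: (roof_left_of_arc KR XP.1).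
have i3 : PF b - PF cR.1 = PlR b - PlR cR.1.
  by apply: (primitive_eq bR2 k0 nk' F_lip lR_lip PFP PlRP) => x /andP[cx _]; exact: F_right.
have i4 : PF cL.1 - PF (- b) = PlL cL.1 - PlL (- b).
  by apply: (primitive_eq bL1 k0 nk F_lip lL_lip PFP PlLP) => x /andP[_ xc]; exact: F_left.
have i5 : PgL Z.1 - PgL (- b) = 0 - 0.
  apply: (primitive_eq bZ1 k0 (lexx 0) gL_lip zlip PgLP zP) => x /andP[_ xZ].
  by apply: (roof_right_of_arc KL ZP.1); rewrite /= lerN2.
have i6 : PgL b - PgL Y.1 = PlL b - PlL Y.1.
  apply: (primitive_eq bY2 k0 nk gL_lip lL_lip PgLP PlLP) => x /andP[Yx _].
  by rewrite -lLE; apply: (roof_left_of_arc KL YP.1); rewrite /= lerN2.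
have X_on : X.2 = lR X.1 by apply: on_lR; exact: (arc_start_on_line KR XP.1).
have Y_on : Y.2 = lL Y.1.
  apply: on_lL; have := arc_start_on_line KL YP.1.
  by rewrite dot_mirror support_fun_mirror.
have W0 : W.2 = 0 := arc_end_on_ground KR WP.1.
have Z0 : Z.2 = 0 := arc_end_on_ground KL ZP.1.
rewrite /sofa_area /Qfun.
rewrite (arc_area_body_B KR PgRP) (arc_area_body_D KL PgLP).
rewrite (segment_area_affine cR_on X_on) (segment_area_affine Y_on cL_on).
rewrite (curve_area_graph phi_le_phiL k0 corner_fst_continuous corner_fst_BV F_lip PFP);
  last by move=> t tI; rewrite F_corner.
rewrite W0 Z0 !mulr0 -/(PlR _) -/(PlL _) -/(PlR _) -/(PlL _).
move: N i1 i2 i3 i4 i5 i6; rewrite -/(PlR _) -/(PlR _) -/(PlL _) -/(PlL _).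
lra.
Qed.

End sofa_upper_bound.

(** Between the support lines at [phi] and [pi - phi] the cap is no wider at any
   height than at the ground. *)
Lemma arch_area_le (R : realType) (phi : R) (K : set (R * R)) :
  0 < phi < pi / 2 -> arch K ->
  area K <= (support_fun K phi + support_fun K (pi - phi)) / cos phi.
Proof.
move=> angle [cK K0 _ st _ _ _]; have pi0 := @pi_gt0 R.
have sn : 0 < sin phi by apply: sin_gt0_pi; lra.
have cs : 0 < cos phi by apply: cos_gt0_pihalf; lra.
have box p : K p -> - (support_fun K (pi - phi) / cos phi) <= p.1 <= support_fun K phi / cos phi.
  move=> Kp; have /andP[p0 _] := st _ Kp.
  have := support_ub cK K0 phi Kp; have := support_ub cK K0 (pi - phi) Kp.
  rewrite -mirror_u -dot_mirror !dot_u /= => h1 h2.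
  have ps : 0 <= p.2 * sin phi by rewrite mulr_ge0// ltW.
  by rewrite ler_pdivlMr// lerNl ler_pdivlMr//; lra.
have [q Kq] := K0; have /andP[q1 q2] := box _ Kq.
have := @area_le_rect R K _ _ 0 1 (le_trans q1 q2) ler01.
rewrite subr0 mulr1 opprK addrC -mulrDl addrC; apply.
move=> p Kp; split; rewrite /= in_itv/=; first exact: box.
exact: st.
Qed.

Theorem theorem8p2p4 (R : realType) (p q phi theta : R)
    (hphi : gerver_constants p q phi theta) (K : set (R * R)) (hK : Ki K) :
  sofa_area K <= Qfun phi K (body_B phi K) (body_D phi K).
Proof.
have A := Ki_arch hK; have pi0 := @pi_gt0 R.
have [[f0 ft t4] _] := hphi.
apply: arch_sofa_area_le => //; first lra.
have angle : 0 < phi < pi / 2 by lra.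
have cs : 0 < cos phi by apply: cos_gt0_pihalf; lra.
have [_ a22 _] := hK.
apply: le_trans (gerver_phi_bound hphi) _.
by have := le_trans a22 (arch_area_le angle A); rewrite ler_pdivlMr.
Qed.
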